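(* Let $\phi=e^{i\alpha}\tilde p/p$ be a normalized rational inner function of bidegree $(1,n)$, let $\Phi=(\phi,z_2)$ be the associated rational inner skew-product, and suppose that the associated polynomial $Q_\alpha$ is not identically zero. Let $(\tau,\lambda)\in\mathbb{T}^2$ be a singular fixed point (SF-point) of $\Phi$. (1) If $Q_\alpha(\lambda)\neq0$, then $(\tau,\lambda)$ belongs to a single component of $\Gamma(\Phi)\cap\mathbb{T}^2$. Moreover, this component can be parametrized by an analytic function in some neighborhood of $(\tau,\lambda)$. (2) If $Q_\alpha(\lambda)=0$, then $(\tau,\lambda)$ belongs to two components of $\Gamma(\Phi)\cap\mathbb{T}^2$. If $Q_\alpha$ vanishes to even order at $\lambda$, then each of these components can be parametrized by an analytic function in some neighborhood of $(\tau,\lambda)$.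
   Context: $\mathbb{D}$ is the open unit disk and $\mathbb{T}$ the unit circle. For $p\in\mathbb{C}[z_1,z_2]$ of bidegree $(1,n)$ (degree $1$ in $z_1$ and $n$ in $z_2$) the reflection is $\tilde p(z_1,z_2)=z_1z_2^n\overline{p(1/\bar z_1,1/\bar z_2)}$. A normalized rational inner function of bidegree $(1,n)$ is $\phi=e^{i\alpha}\tilde p/p$ with $\alpha\in\mathbb{R}$, $p$ of bidegree $(1,n)$ without zeros in $\mathbb{D}^2$, and $p,\tilde p$ without common factors. Write $p(z)=p_1(z_2)+z_1p_2(z_2)$ with $p_1,p_2\in\mathbb{C}[z_2]$; then $\tilde p(z)=\tilde p_2(z_2)+z_1\tilde p_1(z_2)$, where $\tilde p_j(z_2)=z_2^n\overline{p_j(1/\bar z_2)}$. Define $Q_\alpha(z_2)=(p_1(z_2)-e^{i\alpha}\tilde p_1(z_2))^2+4e^{i\alpha}p_2(z_2)\tilde p_2(z_2)$. At every point of $\mathbb{T}^2$ the function $\phi$ has a unimodular non-tangential limit $\phi^*$, taken as its value there; $\Phi(z_1,z_2)=(\phi(z_1,z_2),z_2)$. A singular point of $\phi$ is a point $\tau\in\mathbb{T}^2$ with $p(\tau)=0$ (then also $\tilde p(\tau)=0$). An SF-point of $\Phi$ is a singular point $(\tau,\lambda)\in\mathbb{T}^2$ of $\phi$ that is fixed: $\phi^*(\tau,\lambda)=\tau$. $\Gamma(\Phi)$ is the zero set in $\overline{\mathbb{D}^2}$ of $P_\alpha(z_1,z_2)=e^{i\alpha}\tilde p(z_1,z_2)-z_1p(z_1,z_2)$;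 it consists of the fixed points of $\Phi$ together with the singular points of $\phi$. For $p_2(z_2)\neq0$ the zeros of $P_\alpha$ in $z_1$ are $\psi^{1,2}_\alpha(z_2)=\frac{1}{2p_2(z_2)}\left(-(p_1(z_2)-e^{i\alpha}\tilde p_1(z_2))\pm\sqrt{Q_\alpha(z_2)}\right)$. ''Components'' of $\Gamma(\Phi)\cap\mathbb{T}^2$ means the curves (branches) $z_1=\psi^j_\alpha(z_2)$, $j=1,2$, in $\mathbb{T}^2$ (not connected components in the topological sense). *)

(* Defs.v *)
From HB Require Import structures.
From mathcomp Require Import all_boot all_order all_algebra.
From mathcomp Require Import all_classical all_reals all_analysis.
From mathcomp Require Import complex polyXY.

Set Implicit Arguments.
Unset Strict Implicit.
Unset Printing Implicit Defensive.

Import Order.TTheory GRing.Theory Num.Theory.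
Import numFieldNormedType.Exports.

Local Open Scope classical_set_scope.
Local Open Scope ring_scope.

(* R[i] carries the topology that MathComp-Analysis puts on every numFieldType;
   unification does not find it on the head constant complex by itself. *)
HB.instance Definition _ (R : rcfType) := NormedModule.copy R[i]%C R[i]%C^o.

Section Defs.
Variable R : realType.
Local Notation C := (R[i]%C).

(* C[z1,z2] is {poly {poly C}}: the outer variable 'X is z1, the inner one is
   z2, so p`_i is the coefficient of z1^i (a polynomial in z2) and p.[z1, z2]
   is the value at (z1, z2). *)
Implicit Types (p : {poly {poly C}}) (q : {poly C}).

Definition expi (alpha : R) : C := (cos alpha +i* sin alpha)%C.

(* z2^n * conj (q (1 / conj z2)), for q of degree at most n *)
Definition reflect1 (n : nat) q : {poly C} := \poly_(j < n.+1) (q`_(n - j))^*.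

(* z1 z2^n * conj (p (1 / conj z1, 1 / conj z2)), for p of bidegree at most
   (1, n) *)
Definition reflect (n : nat) p : {poly {poly C}} :=
  \poly_(i < 2) reflect1 n p`_(1 - i).

Lemma reflect1E n q (z2 : C) : (size q <= n.+1)%N -> z2 != 0 ->
  (reflect1 n q).[z2] = z2 ^+ n * (q.[(z2^*)^-1])^*.
Proof.
move=> sq z0; rewrite horner_poly (horner_coef_wide _ sq) rmorph_sum mulr_sumr.
rewrite (reindex_inj rev_ord_inj) /=; apply: eq_bigr => j _.
have jn : (j <= n)%N by rewrite -ltnS.
rewrite rmorphM rmorphXn fmorphV /= conjCK subSS subKn //.
by rewrite -[X in z2 ^+ X](subnK jn) exprD exprVn mulrCA mulfK ?expf_neq0.
Qed.

Lemma reflectE n p (z1 z2 : C) : (size p <= 2)%N -> (sizeY p <= n.+1)%N ->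
  z1 != 0 -> z2 != 0 ->
  (reflect n p).[z1, z2]
  = z1 * z2 ^+ n * (p.[(z1^*)^-1, (z2^*)^-1])^*.
Proof.
move=> sp spY z10 z20.
have sY i : (size (p`_i)%R <= n.+1)%N by apply: leq_trans (max_size_coefXY _ _) spY.
rewrite horner_poly (horner_coef_wide _ sp) !big_ord_recl !big_ord0 /=.
rewrite !expr0 !expr1 !addr0 !mulr1 !hornerD !hornerM !hornerC.
rewrite !reflect1E // rmorphD rmorphM fmorphV /= conjCK mulrDr addrC.
by congr (_ + _); [rewrite mulrC mulrA | rewrite [z1 * _]mulrC -mulrA [z1 * (_ / _)]mulrCA divff ?mulr1].
Qed.

(* The units of C[z1,z2] are the nonzero constants. *)
Definition no_common_factor p p' : Prop :=
  forall d a b, p = a * d -> p' = b * d -> d \is a GRing.unit.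

(* "phi = e^{i alpha} (reflect n p) / p is a normalized rational inner function
   of bidegree (1, n)" *)
Record normalized_denominator (n : nat) p : Prop := NormalizedDenominator {
  deg_z1 : size p = 2;
  deg_z2 : sizeY p = n.+1;
  no_zero_bidisk : forall z1 z2 : C, `|z1| < 1 -> `|z2| < 1 -> p.[z1, z2] != 0;
  coprime_reflect : no_common_factor p (reflect n p)
}.

Definition phi (n : nat) (alpha : R) p (z : C * C) : C :=
  expi alpha * (reflect n p).[z.1, z.2] / p.[z.1, z.2].

(* |z - zeta|_oo <= c (1 - |z|_oo), written coordinatewise *)
Definition nt_region (c : R) (zeta : C * C) : set (C * C) :=
  [set z | [/\ `|z.1| < 1, `|z.2| < 1 &
    [/\ `|z.1 - zeta.1| <= (c%:C)%C * (1 - `|z.1|),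
        `|z.1 - zeta.1| <= (c%:C)%C * (1 - `|z.2|),
        `|z.2 - zeta.2| <= (c%:C)%C * (1 - `|z.1|) &
        `|z.2 - zeta.2| <= (c%:C)%C * (1 - `|z.2|)]]].

Definition nt_limit (f : C * C -> C) (zeta : C * C) (l : C) : Prop :=
  forall c : R, 0 < c -> f z @[z --> within (nt_region c zeta) (nbhs zeta)] --> l.

Definition torus : set (C * C) := [set z | `|z.1| = 1 /\ `|z.2| = 1].

Definition singular_point p (z : C * C) : Prop := torus z /\ p.[z.1, z.2] = 0.

Definition SF_point (n : nat) (alpha : R) p (z : C * C) : Prop :=
  singular_point p z /\ nt_limit (phi n alpha p) z z.1.

Definition Palpha (n : nat) (alpha : R) p : {poly {poly C}} :=
  (expi alpha)%:P%:P * reflect n p - 'X * p.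

Definition Gamma (n : nat) (alpha : R) p : set (C * C) :=
  [set z | [/\ `|z.1| <= 1, `|z.2| <= 1 & (Palpha n alpha p).[z.1, z.2] = 0]].

Definition Qalpha (n : nat) (alpha : R) p : {poly C} :=
  (p`_0 - expi alpha *: reflect1 n p`_0) ^+ 2
  + 4%:R *: (expi alpha *: (p`_1 * reflect1 n p`_1)).

(* The labelling of the two zeros psi^1, psi^2 of Palpha in z1 depends on which
   square root of Qalpha is taken at each z2; s stands for such a choice. *)
Definition is_sqrtQ (n : nat) (alpha : R) p (s : C -> C) : Prop :=
  forall z2, s z2 ^+ 2 = (Qalpha n alpha p).[z2].

(* psi^1 is j = false (sign +), psi^2 is j = true (sign -) *)
Definition psi (n : nat) (alpha : R) p (s : C -> C) (j : bool) (z2 : C) : C :=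
  (2%:R * (p`_1).[z2])^-1 *
  (- ((p`_0).[z2] - expi alpha * (reflect1 n p`_0).[z2]) + (-1) ^+ j * s z2).

Definition component (n : nat) (alpha : R) p (s : C -> C) (j : bool) :
    set (C * C) :=
  Gamma n alpha p `&` torus `&`
  [set z | (p`_1).[z.2] != 0 /\ z.1 = psi n alpha p s j z.2].

Definition analytic_at (f : C -> C) (x : C) : Prop :=
  exists a : nat -> C,
    \forall z \near x, series (fun k => a k * (z - x) ^+ k) @ \oo --> f z.

(* Near zeta, the subset A of the torus is the curve z1 = g(z2), z2 in the unit
   circle, with g analytic. As A lies in the torus, this forces |g(z2)| = 1 for
   |z2| = 1 close to zeta.2. *)
Definition analytically_parametrized (A : set (C * C)) (zeta : C * C) : Prop :=
  exists g : C -> C,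
    [/\ analytic_at g zeta.2, g zeta.2 = zeta.1 &
        \forall z \near zeta, A z <-> `|z.2| = 1 /\ z.1 = g z.2].

End Defs.

(* Main.v *)
Require Import Defs.
From mathcomp Require Import all_boot all_order all_algebra.
From mathcomp Require Import all_classical all_reals all_analysis.
From mathcomp Require Import complex polyXY.
From mathcomp Require Import ring.

(** Write [p = p1 + z1 p2], [w = exp(i alpha)] and [q# = reflect1 n q].  The fixed
    point polynomial is [P = w q2# - b z1 - p2 z1^2] with [q2# = reflect1 n p2] and
    [b = p1 - w p1#], and [Q] is its discriminant in [z1].  On the unit circle
    [q#(z) = z^n conj (q z)]; hence with [v = w z^n] one has [b = - v conj b] and
    [Q = v (4 |p2|^2 - |b|^2)], so the real number [4 |p2|^2 - |b|^2] is the
    discriminant up to a unimodular factor.  Where [p2 != 0], the two roots of [P(., z)] are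
    both unimodular when it is nonnegative ([norm_psi]), and when it is negative there is
    no unimodular root ([hyperbolic_root]).  The whole theorem thus asks on which
    side of zero this number lies near [lambda].

    At a singular point [p2(lambda) != 0], since otherwise [z2 - lambda] would divide
    both [p] and its reflection; and [P(tau, lambda) = 0].

    If [Q(lambda) != 0], the roots [psi^1], [psi^2] are distinct at [lambda], exactly
    one of them is [tau], and the discriminant number is positive at [lambda], hence
    nearby.

    If [Q(lambda) = 0], then [tau] is a double root.  The point is to find, as close
    to [lambda] as desired, unimodular roots over points of the circle where
    [Q != 0] ([double_root_hyperbolic]).  These come from the other family of slices.
    For fixed unimodular [t] the polynomial [h = p1 + t p2] has no zero in the disk
    ([slice_rootfree]), and [P(t, .) = t (w h# - h)]; since [|h#| <= |h|] in the disk
    with equality only when [h#] is a multiple of [h], all roots of [P(t, .)] lie on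
    the circle unless it vanishes identically ([self_inversive_root_circle]).  As [t]
    tends to [tau], a root of [P(t, .)] has to tend to [lambda], because [P(tau, lambda) = 0]
    ([double_root_approached]).  At the points so obtained the two sets
    [component s j] differ, which separates the two components.

    When [Q = (z - lambda)^(2m) Q1] with [Q1(lambda) != 0], the discriminant number is
    [|z - lambda|^(2m) F(z)] on the circle, where [F] is continuous, [F(lambda) != 0],
    and [F] is real off [lambda]; so [F] keeps near [lambda] the positive sign it has
    at the points just found ([hyperbolic_near]), and both roots stay on the circle.
    They are analytic because [s = (z - lambda)^m sqrt Q1] is.  Analyticity is
    handled through the estimates [|f - S_N| <= M (rho |z - l|)^N] on Taylor
    remainders, a class closed under sums and products which contains inverses and
    square roots of polynomials nonvanishing at the centre. *)

Import Order.TTheory GRing.Theory Num.Theory.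
Import numFieldNormedType.Exports.
Local Open Scope ring_scope.

Set Implicit Arguments.
Unset Strict Implicit.
Unset Printing Implicit Defensive.

(** * Zeros of complex polynomials *)

Section Zeros.
Variable C : numClosedFieldType.
Implicit Types (f q : {poly C}) (x y z w a b c d e : C).

Lemma le_mul_small_eq0 x c :
  0 <= x -> 0 <= c -> (forall t, 0 < t -> t < 1 -> x <= c * t) -> x = 0.
Proof.
move=> x0 c0 H; apply/eqP; apply: contraT => xN0.
have xp : 0 < x by rewrite lt0r xN0.
have cxp : 0 < c + x by rewrite ltr_wpDl.
have c2p : 0 < 2 * (c + x) by rewrite mulr_gt0.
have := H (x / (2 * (c + x))); rewrite divr_gt0 // ltr_pdivrMr // mul1r.
have -> : x < 2 * (c + x).
  by rewrite mulr_natl mulr2n -[X in X < _]add0r ltr_leD ?lerDr.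
move=> /(_ isT isT); rewrite mulrA ler_pdivlMr // [c * x]mulrC ler_pM2l //.
rewrite mulr_natl mulr2n => Hc.
have : c + x <= c + 0 by rewrite addr0 (le_trans _ Hc) // lerDl (ltW cxp).
by rewrite lerD2l => x00; rewrite (le_gtF x00) in xp.
Qed.

Lemma poly_prod_roots n f : f != 0 -> (size f <= n.+1)%N ->
  exists2 rs, f = lead_coef f *: \prod_(a <- rs) ('X - a%:P) & (size rs <= n)%N.
Proof.
move=> f0 sf; have [rs Ef] := closed_field_poly_normal f; exists rs => //.
by move: sf; rewrite {1}Ef size_scale ?lead_coef_eq0 // size_prod_XsubC.
Qed.

Lemma poly0_of_horner f : (forall z, f.[z] = 0) -> f = 0.
Proof.
move=> H; apply/eqP; apply: contraT => f0.
pose s := [seq i%:R : C | i <- iota 0 (size f)].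
have us : uniq s.
  by rewrite map_inj_uniq ?iota_uniq // => i j /eqP; rewrite eqr_nat => /eqP.
have := max_poly_roots f0 _ us; rewrite size_map size_iota ltnn; apply.
by apply/allP => x _; apply/rootP/H.
Qed.

(** A quantitative Hurwitz principle: for each root [a] one has
    [d |z - a| <= (d + |z - w|) |w - a|], and the product over the at most [n] roots
    gives a Harnack type bound whose constant does not depend on [f].  Being
    uniform, it survives limits in which roots escape to infinity. *)
Lemma le_horner_rootfree n f w z d : (size f <= n.+1)%N -> 0 < d ->
  (forall a, root f a -> d <= `|w - a|) ->
  `|f.[z]| * d ^+ n <= (d + `|z - w|) ^+ n * `|f.[w]|.
Proof.
move=> sf d0 H; have [->|f0] := eqVneq f 0; first by rewrite !horner0 !normr0 mul0r mulr0.
have [rs Ef srs] := poly_prod_roots f0 sf.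
have Hrs a : a \in rs -> d <= `|w - a|.
  by move=> ars; apply: H; rewrite Ef rootZ ?lead_coef_eq0 // root_prod_XsubC.
have dz : 0 <= d + `|z - w| by rewrite addr_ge0 // ltW.
rewrite Ef !hornerZ !normrM mulrCA -mulrA ler_wpM2l //.
clear Ef f0 H; elim: rs n srs {sf} Hrs => [|a rs IH] n srs Hrs.
  rewrite !big_nil !hornerC normr1 mul1r mulr1 lerXn2r ?nnegrE ?(ltW d0) //.
  by rewrite lerDl.
case: n srs => // n srs; rewrite !big_cons !hornerM !hornerXsubC !normrM.
have {}IH := IH n srs (fun b brs => Hrs b (mem_behead (s := a :: rs) brs)).
set u := `|_.[z]| in IH *; set v := `|_.[w]| in IH *.
rewrite !exprS; have -> : `|z - a| * u * (d * d ^+ n) = (`|z - a| * d) * (u * d ^+ n) by ring.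
have -> : (d + `|z - w|) * (d + `|z - w|) ^+ n * (`|w - a| * v)
  = ((d + `|z - w|) * `|w - a|) * ((d + `|z - w|) ^+ n * v) by ring.
have da := Hrs a (mem_head _ _).
apply: ler_pM => //; rewrite ?mulr_ge0 ?exprn_ge0 ?normr_ge0 ?(ltW d0) //.
have -> : z - a = (z - w) + (w - a) by ring.
apply: le_trans (_ : (`|z - w| + `|w - a|) * d <= _).
  by rewrite ler_wpM2r ?(ltW d0) // ler_normD.
rewrite !mulrDl addrC; apply: lerD; first by rewrite mulrC.
by rewrite ler_wpM2l.
Qed.

(** Hurwitz's theorem for polynomials of bounded degree: a limit of polynomials
    with no root within [d] of [w] cannot vanish at [w] unless it vanishes
    identically. *)
Lemma rootfree_limit n f (g : C -> {poly C}) w d : 0 < d ->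
  (forall t, 0 < t -> t < 1 -> (size (g t) <= n.+1)%N) ->
  (forall t, 0 < t -> t < 1 -> forall a, root (g t) a -> d <= `|w - a|) ->
  (forall z, exists2 k, 0 <= k & forall t, 0 < t -> t < 1 -> `|f.[z] - (g t).[z]| <= k * t) ->
  f.[w] = 0 -> f = 0.
Proof.
move=> d0 sg rg lim fw; apply: poly0_of_horner => z.
have [k k0 Hk] := lim z; have [k' k'0 Hk'] := lim w.
apply/eqP; rewrite -normr_eq0; apply/eqP.
have dn : 0 < d ^+ n by rewrite exprn_gt0.
pose e := (d + `|z - w|) ^+ n.
have e0 : 0 <= e by rewrite exprn_ge0 // addr_ge0 // ltW.
suff : `|f.[z]| * d ^+ n = 0 by move/eqP; rewrite mulf_eq0 (gt_eqF dn) orbF => /eqP.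
apply: (@le_mul_small_eq0 _ (k * d ^+ n + e * k')).
- by rewrite mulr_ge0 ?(ltW dn).
- by rewrite addr_ge0 ?mulr_ge0 ?(ltW dn).
move=> t t0 t1.
have -> : f.[z] = (f.[z] - (g t).[z]) + (g t).[z] by ring.
apply: le_trans (_ : (`|f.[z] - (g t).[z]| + `|(g t).[z]|) * d ^+ n <= _).
  by rewrite ler_wpM2r ?(ltW dn) // ler_normD.
rewrite !mulrDl; apply: lerD.
  by rewrite mulrAC ler_wpM2r ?(ltW dn) // Hk.
apply: le_trans (le_horner_rootfree z (sg t t0 t1) d0 (rg t t0 t1)) _.
rewrite -mulrA -/e ler_wpM2l // -normrN.
have -> : - (g t).[w] = f.[w] - (g t).[w] by rewrite fw sub0r.
exact: Hk'.
Qed.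
Lemma horner_neq0_prod q z : q.[z] != 0 ->
  exists c rs, q = c *: \prod_(a <- rs) ('X - a%:P) /\ z \notin rs.
Proof.
have [rs Eq] := closed_field_poly_normal q => qz.
exists (lead_coef q), rs; split=> //; apply: contraNN qz => zrs.
rewrite Eq hornerZ.
have /rootP -> : root (\prod_(a <- rs) ('X - a%:P)) z by rewrite root_prod_XsubC.
by rewrite mulr0.
Qed.

End Zeros.

(** * Functions with a power series expansion *)

Section PowerSeries.
Variable C : numClosedFieldType.
Implicit Types (f g : C -> C) (q : {poly C}) (x z w l c : C).

(** [a] is the Taylor sequence of [f] at [l], expressed by remainder estimates
    instead of a limit: sums and products are then finite computations, and no
    completeness of the field is needed. *)
Definition power_series_bound l f (a : nat -> C) (M rho : C) : Prop :=
  forall z, rho * `|z - l| <= 1 -> forall N : nat,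
    `|f z - \sum_(k < N) a k * (z - l) ^+ k| <= M * (rho * `|z - l|) ^+ N.

Definition has_power_series l f : Prop :=
  exists (a : nat -> C) (M rho : C),
    [/\ 0 <= M, 0 < rho & power_series_bound l f a M rho].

Lemma power_series_bound_widen l f a M rho rho' : 0 <= M -> 0 <= rho -> rho <= rho' ->
  power_series_bound l f a M rho -> power_series_bound l f a M rho'.
Proof.
move=> M0 r0 rr' H z zr N.
have le_r : rho * `|z - l| <= rho' * `|z - l| by rewrite ler_wpM2r.
apply: le_trans (H z (le_trans le_r zr) N) _; rewrite ler_wpM2l //.
by rewrite lerXn2r ?nnegrE ?mulr_ge0 // (le_trans r0).
Qed.

Lemma eq_has_power_series l f g : f =1 g -> has_power_series l f -> has_power_series l g.
Proof.
move=> fg [a [M [r [M0 r0 H]]]]; exists a, M, r; split=> // z zr N.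
by rewrite -fg; exact: H.
Qed.

Lemma has_power_series_cst l c : has_power_series l (fun=> c).
Proof.
exists (fun k => if k is 0 then c else 0), `|c|, 1; split => // z _ [|N].
  by rewrite big_ord0 subr0 expr0 mulr1.
rewrite big_ord_recl big1 => [|i _]; last by rewrite mul0r.
by rewrite mulr1 addr0 subrr normr0 mulr_ge0 ?exprn_ge0 ?mulr_ge0.
Qed.

Lemma has_power_series_id l : has_power_series l (fun z => z).
Proof.
exists (fun k => match k with 0 => l | 1 => 1 | _ => 0 end), (1 + `|l|), 1.
have M0 : 0 <= 1 + `|l| by rewrite addr_ge0.
split => // z; rewrite mul1r => z1 [|[|N]].
- rewrite big_ord0 subr0 mulr1 -{1}[z](subrK l).
  by apply: le_trans (ler_normD _ _) _; rewrite lerD2r.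
- by rewrite big_ord1 expr0 mulr1 expr1 -[leLHS]mul1r ler_wpM2r // lerDl.
- rewrite !big_ord_recl big1 => [|i _]; last by rewrite mul0r.
  have -> : z - (l * (z - l) ^+ 0 + (1 * (z - l) ^+ 1 + 0)) = 0 by ring.
  by rewrite normr0 mulr_ge0 ?exprn_ge0.
Qed.

Lemma has_power_series_add l f g : has_power_series l f -> has_power_series l g ->
  has_power_series l (fun z => f z + g z).
Proof.
move=> [a [M [r [M0 r0 Hf]]]] [b [M' [r' [M'0 r'0 Hg]]]].
exists (fun k => a k + b k), (M + M'), (r + r'); split; rewrite ?addr_ge0 ?addr_gt0 //.
move=> z zr N.
have -> : f z + g z - \sum_(k < N) (a k + b k) * (z - l) ^+ k =
  (f z - \sum_(k < N) a k * (z - l) ^+ k) + (g z - \sum_(k < N) b k * (z - l) ^+ k).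
  rewrite addrACA -opprD -big_split; congr (_ - _); apply: eq_bigr => k _.
  by rewrite mulrDl.
apply: le_trans (ler_normD _ _) _; rewrite mulrDl; apply: lerD.
  by apply: (power_series_bound_widen M0 (ltW r0) _ Hf); rewrite // lerDl ltW.
by apply: (power_series_bound_widen M'0 (ltW r'0) _ Hg); rewrite // lerDr ltW.
Qed.

Lemma sum_cauchy (a b : nat -> C) w N :
  \sum_(k < N) (\sum_(i < k.+1) a i * b (k - i)%N) * w ^+ k =
  \sum_(i < N) a i * w ^+ i * \sum_(j < N - i) b j * w ^+ j.
Proof.
elim: N => [|N IH]; first by rewrite !big_ord0.
rewrite big_ord_recr /= IH [in RHS]big_ord_recr /= subSnn big_ord1.
rewrite [in LHS]big_ord_recr /= subnn expr0 mulr1.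
have -> : \sum_(i < N) a i * w ^+ i * (\sum_(j < N.+1 - i) b j * w ^+ j) =
  \sum_(i < N) (a i * w ^+ i * (\sum_(j < N - i) b j * w ^+ j)
     + a i * b (N - i)%N * w ^+ N).
  apply: eq_bigr => i _; rewrite subSn ?(ltnW (ltn_ord i)) // big_ord_recr /=.
  have e : w ^+ N = w ^+ i * w ^+ (N - i) by rewrite -exprD subnKC ?(ltnW (ltn_ord i)).
  by rewrite mulrDr e; congr (_ + _); ring.
by rewrite big_split /= -mulr_suml -addrA; congr (_ + _); rewrite mulrDl [in RHS]mulrAC.
Qed.

(** The remainder of a truncated Cauchy product, written with the remainders of
    the two factors only. *)
Lemma product_remainder (u v : C) (a b : nat -> C) w N :
  u * v - \sum_(k < N) (\sum_(i < k.+1) a i * b (k - i)%N) * w ^+ k =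
  (u - \sum_(i < N) a i * w ^+ i) * v
  + \sum_(i < N) a i * w ^+ i * (v - \sum_(j < N - i) b j * w ^+ j).
Proof.
rewrite sum_cauchy.
have -> : \sum_(i < N) a i * w ^+ i * (v - \sum_(j < N - i) b j * w ^+ j) =
    (\sum_(i < N) a i * w ^+ i) * v
    - \sum_(i < N) a i * w ^+ i * \sum_(j < N - i) b j * w ^+ j.
  by rewrite mulr_suml -sumrB; apply: eq_bigr => i _; rewrite mulrBr.
ring.
Qed.

Lemma power_series_coef_le l f a M rho z k : 0 <= M -> 0 <= rho ->
  power_series_bound l f a M rho -> rho * `|z - l| <= 1 ->
  `|a k * (z - l) ^+ k| <= 2 * M * (rho * `|z - l|) ^+ k.
Proof.
move=> M0 r0 H zr; have := H z zr k.+1; have := H z zr k; rewrite big_ord_recr /=.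
set S := \sum_(i < k) _ => H1 H2.
have -> : a k * (z - l) ^+ k = (f z - S) - (f z - (S + a k * (z - l) ^+ k)) by ring.
apply: le_trans (ler_normB _ _) _; rewrite mulr_natl mulr2n mulrDl lerD //.
apply: le_trans H2 _; rewrite exprS ler_wpM2l //.
by rewrite -[leRHS]mul1r ler_wpM2r // exprn_ge0 // mulr_ge0.
Qed.

(** The remainder of the product is at most [(1 + 2 N) M M' x^N]; doubling [rho]
    absorbs the factor [1 + 2 N <= 2 * 2^N]. *)
Lemma has_power_series_mul l f g : has_power_series l f -> has_power_series l g ->
  has_power_series l (fun z => f z * g z).
Proof.
move=> [a [M [r [M0 r0 Hf]]]] [b [M' [r' [M'0 r'0 Hg]]]].
have {}Hf : power_series_bound l f a M (r + r').
  by apply: (power_series_bound_widen M0 (ltW r0) _ Hf); rewrite lerDl ltW.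
have {}Hg : power_series_bound l g b M' (r + r').
  by apply: (power_series_bound_widen M'0 (ltW r'0) _ Hg); rewrite lerDr ltW.
set s := r + r' in Hf Hg; have s0 : 0 < s by rewrite addr_gt0.
exists (fun k => \sum_(i < k.+1) a i * b (k - i)%N), (2 * (M * M')), (2 * s).
split; rewrite ?mulr_ge0 ?mulr_gt0 // => z; set w := z - l; rewrite -mulrA.
set x := s * `|w| => x2 N; rewrite product_remainder.
have x0 : 0 <= x by rewrite mulr_ge0 // ltW.
have x1 : x <= 1 by apply: le_trans x2; rewrite mulr_natl mulr2n lerDl.
have MM0 : 0 <= M * M' by rewrite mulr_ge0.
have g0 : `|g z| <= M' by have := Hg z x1 0; rewrite big_ord0 subr0 mulr1.
apply: le_trans (_ : M * M' * x ^+ N + \sum_(i < N) 2 * (M * M') * x ^+ N <= _).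
  apply: le_trans (ler_normD _ _) _; apply: lerD.
    by rewrite normrM mulrAC ler_pM // Hf.
  apply: le_trans (ler_norm_sum _ _ _) _; apply: ler_sum => i _.
  have iN : (i <= N)%N by rewrite ltnW.
  have -> : 2 * (M * M') * x ^+ N = (2 * M * x ^+ i) * (M' * x ^+ (N - i)).
    by rewrite -[in LHS](subnKC iN) exprD; ring.
  rewrite normrM ler_pM // ?Hg //.
  exact: (power_series_coef_le i M0 (ltW s0) Hf x1).
have MMx0 : 0 <= M * M' * x ^+ N by rewrite mulr_ge0 ?exprn_ge0.
rewrite sumr_const card_ord (exprMn _ 2 x) -(mulr_natr (2 * (M * M') * x ^+ N) N).
have -> : M * M' * x ^+ N + 2 * (M * M') * x ^+ N * N%:R
  = (M * M' * x ^+ N) * (1 + 2 * N%:R) by ring.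
have -> : 2 * (M * M') * (2 ^+ N * x ^+ N) = (M * M' * x ^+ N) * (2 * 2 ^+ N) by ring.
rewrite ler_wpM2l // -natrX -!natrM addrC natr1 ler_nat.
by rewrite ltn_pmul2l // ltn_expl.
Qed.

Lemma has_power_series_horner l (q : {poly C}) : has_power_series l (fun z => q.[z]).
Proof.
elim/poly_ind: q => [|q c IH].
  by apply: eq_has_power_series (has_power_series_cst l 0) => z; rewrite horner0.
have Hm := has_power_series_mul IH (has_power_series_id l).
apply: eq_has_power_series (has_power_series_add Hm (has_power_series_cst l c)) => z.
by rewrite hornerD hornerMX hornerC.
Qed.

Lemma has_power_series_scale l f c : c != 0 -> has_power_series 0 f ->
  has_power_series l (fun z => f (c * (z - l))).
Proof.
move=> c0 [a [M [r [M0 r0 H]]]]; exists (fun k => a k * c ^+ k), M, (r * `|c|).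
split; rewrite ?mulr_gt0 ?normr_gt0 // => z; rewrite -mulrA -normrM => zr N.
have := H (c * (z - l)); rewrite subr0 => /(_ zr N).
by under eq_bigr => i _ do rewrite exprMn mulrA.
Qed.

Lemma has_power_series_geometric : has_power_series 0 (fun x : C => (1 - x)^-1).
Proof.
exists (fun=> 1), 2, 2; split=> // z; rewrite subr0 => z2 N.
have z1 : 1 <= 2 * `|1 - z|.
  have : 2 * `|1 : C| <= 2 * (`|1 - z| + `|z|).
    by rewrite ler_pM2l // -{1}(subrK z 1) ler_normD.
  rewrite normr1 mulr1 mulrDr => H.
  have := lerB H z2; by rewrite !addrK.
have n0 : 1 - z != 0.
  by apply: contraTneq z1 => ->; rewrite normr0 mulr0 ler10.
have -> : (1 - z)^-1 - \sum_(k < N) 1 * z ^+ k = z ^+ N * (1 - z)^-1.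
  apply: (mulIf n0); rewrite mulrBl mulVf // mulfVK //.
  under eq_bigr => i _ do rewrite mul1r.
  have -> : (\sum_(k < N) z ^+ k) * (1 - z) = - ((z - 1) * \sum_(k < N) z ^+ k) by ring.
  by rewrite -subrX1; ring.
rewrite normrM normfV normrX mulrC exprMn.
apply: ler_pM; rewrite ?invr_ge0 ?exprn_ge0 //.
  by rewrite -[_^-1]mul1r ler_pdivrMr ?normr_gt0.
by rewrite -[leLHS]mul1r ler_wpM2r ?exprn_ge0 ?exprn_ege1 // ler1n.
Qed.

Lemma has_power_series_invXsubC l b : l != b -> has_power_series l (fun z => (z - b)^-1).
Proof.
move=> lb; have bl : b - l != 0 by rewrite subr_eq0 eq_sym.
have bl' : (b - l)^-1 != 0 by rewrite invr_eq0.
have H := has_power_series_mul (has_power_series_cst l (- (b - l)^-1))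
  (has_power_series_scale l bl' has_power_series_geometric).
apply: eq_has_power_series H => z.
rewrite -invrN -invfM; congr (_^-1); rewrite mulrBr mulr1 !mulNr mulVKf //; ring.
Qed.

Lemma has_power_series_inv_horner l (q : {poly C}) : q.[l] != 0 ->
  has_power_series l (fun z => q.[z]^-1).
Proof.
move=> /horner_neq0_prod [c [rs [->]]].
elim: rs => [_|a rs IH].
  apply: eq_has_power_series (has_power_series_cst l c^-1) => z.
  by rewrite big_nil hornerZ hornerC mulr1.
rewrite inE negb_or => /andP [la /IH H].
apply: eq_has_power_series (has_power_series_mul (has_power_series_invXsubC la) H) => z.
by rewrite big_cons !hornerZ hornerM hornerXsubC !invfM; ring.
Qed.

Lemma has_power_series_lipschitz l f : has_power_series l f ->
  exists2 K, 0 < K & forall z, K * `|z - l| <= 1 -> `|f z - f l| <= K * `|z - l|.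
Proof.
move=> [a [M [r [M0 r0 H]]]].
have El : f l = a 0%N.
  have := H l; rewrite subrr normr0 mulr0 => /(_ ler01 1%N).
  rewrite big_ord1 expr0 mulr1 expr1 mulr0 normr_le0 subr_eq0.
  by move/eqP.
exists (r * (1 + M)); first by rewrite mulr_gt0 // ltr_wpDr.
move=> z zr; have rz : r * `|z - l| <= 1.
  apply: le_trans zr; rewrite ler_wpM2r // -[leLHS]mulr1 ler_pM2l // lerDl //.
have := H z rz 1%N; rewrite big_ord1 expr0 mulr1 expr1 El => /le_trans; apply.
by rewrite mulrA [M * r]mulrC ler_wpM2r // ler_pM2l // lerDr.
Qed.

Lemma course_of_values_rec (T : Type) (F : seq T -> T) :
  exists y : nat -> T, forall n, y n = F (mkseq y n).
Proof.
pose s := fix s n := if n is m.+1 then rcons (s m) (F (s m)) else [::].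
exists (fun n => F (s n)) => n; congr F.
by elim: n => //= n IH; rewrite mkseqS -IH.
Qed.

(** The Taylor coefficients of [y = 1 - sqrt (1 - x)], read off the equation
    [2 y = x + y^2].  They are nonnegative, and the partial sums [S] of their series at
    [1] satisfy [2 S_(N+1) <= 1 + S_N^2], hence stay below [1]. *)
Lemma exists_sqrt_coef : exists y : nat -> C,
  [/\ y 0%N = 0,
      forall k, 2 * y k = (k == 1%N)%:R + \sum_(i < k.+1) y i * y (k - i)%N,
      forall k, 0 <= y k & forall N, \sum_(k < N) y k <= 1].
Proof.
have [y Hy] := course_of_values_rec (fun s : seq C =>
  2^-1 * ((size s == 1%N)%:R + \sum_(i < size s) s`_i * s`_(size s - i))).
have y0 : y 0%N = 0 by rewrite Hy /= big_ord0 addr0 mulr0.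
have rec k : 2 * y k = (k == 1%N)%:R + \sum_(i < k.+1) y i * y (k - i)%N.
  rewrite [y k in LHS]Hy mulrA divff ?pnatr_eq0 // mul1r size_mkseq; congr (_ + _).
  rewrite big_ord_recr /= subnn y0 mulr0 addr0; apply: eq_bigr => i _.
  rewrite nth_mkseq //; case: i => [[|i] ik] /=; first by rewrite y0 !mul0r.
  by rewrite nth_mkseq // ltn_subrL (leq_ltn_trans _ ik).
have nonneg k : 0 <= y k.
  have [m] := ubnP k; elim: m k => // m IH k km.
  suff : 0 <= 2 * y k by rewrite pmulr_rge0.
  rewrite rec addr_ge0 ?ler0n // sumr_ge0 // => -[[|i] ik] _ /=; first by rewrite y0 mul0r.
  have [->|ki] := eqVneq i.+1 k; first by rewrite subnn y0 mulr0.
  have {}ik : (i.+1 < k)%N by rewrite ltn_neqAle ki -ltnS.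
  apply: mulr_ge0; apply: IH; first exact: leq_trans ik _.
  by rewrite (leq_trans _ (_ : k <= m)%N) // ltn_subrL (ltn_trans _ ik).
exists y; split=> // N; elim: N => [|N IH]; first by rewrite big_ord0.
set S := \sum_(k < N) y k in IH.
have S0 : 0 <= S by rewrite sumr_ge0.
suff : 2 * (\sum_(k < N.+1) y k) <= 2 * 1 by rewrite ler_pM2l.
rewrite mulr_sumr (eq_bigr _ (fun k _ => rec _)) big_split /=.
rewrite mulr_natl mulr2n; apply: lerD.
  rewrite big_ord_recl /= add0r; case: N {IH S S0} => [|N]; first by rewrite big_ord0.
  by rewrite big_ord_recl big1 ?addr0.
have := sum_cauchy y y 1 N.+1; rewrite (eq_bigr (fun k : 'I_N.+1 => \sum_(i < k.+1) y i * y (k - i)%N)); last first.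
  by move=> i _; rewrite expr1n mulr1.
move=> ->; apply: le_trans (_ : S * S <= _); last by rewrite mulr_ile1.
rewrite big_ord_recr /= subSnn big_ord1 y0 mul0r mulr0 addr0 mulr_suml.
apply: ler_sum => -[[|i] iN] _ /=; first by rewrite y0 !mul0r.
rewrite expr1n mulr1 ler_wpM2l // subSS.
rewrite (eq_bigr (fun j : 'I_(N - i)%N => y j)); last by move=> j _; rewrite expr1n mulr1.
rewrite /S -(big_mkord xpredT y) -(big_mkord xpredT y).
by rewrite [leRHS](big_cat_nat (leq0n _) (leq_subr i N)) /= lerDl sumr_ge0.
Qed.

(** The square root [s] with [1 <= |1 + s|] is used.  The remainders [e N] of
    [y = 1 - s] satisfy [(1 + s) e_N = sum_(0 < i < N) y_i x^i e_(N-i)], so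
    [|e_N| <= |x|^N] follows by induction from [sum y_i <= 1]. *)
Lemma exists_sqrt_power_series : exists2 s : C -> C, (forall x, s x ^+ 2 = 1 - x) & has_power_series 0 s.
Proof.
have [y [y0 rec nonneg sum1]] := exists_sqrt_coef.
(* one of 1 + r and 1 - r has modulus at least 1, as they add up to 2 *)
pose s x := let r := sqrtC (1 - x) in if 1 <= `|1 + r| then r else - r.
have s2 x : s x ^+ 2 = 1 - x by rewrite /s; case: ifP => _; rewrite ?sqrrN sqrtCK.
have s1 x : 1 <= `|1 + s x|.
  rewrite /s; case: ifPn => // H; set r := sqrtC _ in H *.
  case: (real_leP (real1 C) (normr_real (1 - r))) => // H1.
  move: H; rewrite -real_ltNge ?normr_real ?real1 // => H2.
  have : `|1 + r| + `|1 - r| < 1 + 1 by rewrite ltrD.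
  rewrite real_ltNge ?realD ?normr_real ?real1 //; case/negP.
  have -> : 1 + 1 = `|(1 + r) + (1 - r)|.
    have -> : (1 + r) + (1 - r) = 2%:R by ring.
    by rewrite normr_nat.
  exact: ler_normD.
exists s => //.
suff H : has_power_series 0 (fun x => 1 - s x).
  have Hm := has_power_series_mul (has_power_series_cst 0 (-1)) H.
  apply: eq_has_power_series (has_power_series_add (has_power_series_cst 0 1) Hm) => x.
  ring.
exists y, 1, 1; split=> // x; rewrite subr0 !mul1r => x1.
set u := 1 - s x.
have Eu : u * (1 + s x) = x by rewrite -[RHS](subKr 1) -(s2 x) /u; ring.
have le_u : `|u| <= `|x|.
  by rewrite -Eu normrM -[leLHS]mulr1 ler_wpM2l.
pose e N := u - \sum_(k < N) y k * x ^+ k.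
have erec N : (1 < N)%N -> (1 + s x) * e N = \sum_(i < N) y i * x ^+ i * e (N - i)%N.
  move=> N1; have := product_remainder u u y y x N.
  rewrite -/(e N) -/(\sum_(i < N) y i * x ^+ i * e (N - i)%N).
  have -> : \sum_(k < N) (\sum_(i < k.+1) y i * y (k - i)%N) * x ^+ k
      = 2 * \sum_(k < N) y k * x ^+ k - x.
    rewrite mulr_sumr.
    have Ex : x = \sum_(k < N) (val k == 1%N)%:R * x ^+ k.
      rewrite (bigD1 (Ordinal N1)) //= mul1r expr1 big1 ?addr0 // => i.
      by rewrite -val_eqE /= => /negPf ->; rewrite mul0r.
    rewrite [X in _ = _ - X]Ex -sumrB; apply: eq_bigr => k _.
    by rewrite mulrA rec; ring.
  set T := \sum_(i < N) y i * x ^+ i * e (N - i)%N; move=> ET.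
  have -> : T = u * u - (2 * (\sum_(k < N) y k * x ^+ k) - x) - e N * u by rewrite ET; ring.
  by rewrite /e -[in X in _ - (_ - X)]Eu /u; ring.
have e_le N : (0 < N)%N -> `|e N| <= `|x| ^+ N.
  have [m] := ubnP N; elim: m N => // m IH [|[|N]] //.
    by rewrite /e big_ord1 y0 mul0r subr0 expr1.
  move=> Nm _; apply: le_trans (_ : `|(1 + s x) * e N.+2| <= _).
    by rewrite normrM -[leLHS]mul1r ler_wpM2r.
  rewrite erec //; apply: le_trans (ler_norm_sum _ _ _) _.
  apply: le_trans (_ : \sum_(i < N.+2) y i * `|x| ^+ N.+2 <= _).
    apply: ler_sum => -[[|i] iN] _ /=; first by rewrite y0 !mul0r normr0.
    rewrite !normrM normrX (ger0_norm (nonneg _)) -mulrA ler_wpM2l //.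
    have iN' : (i.+1 <= N.+2)%N by rewrite ltnW.
    rewrite -{2}(subnKC iN') exprD ler_wpM2l ?exprn_ge0 // IH ?subn_gt0 //.
    by rewrite subSS (leq_ltn_trans (leq_subr _ _)).
  by rewrite -mulr_suml -[leRHS]mul1r ler_wpM2r ?exprn_ge0.
case=> [|N]; rewrite mul1r; last exact: e_le.
by rewrite big_ord0 subr0 (le_trans le_u).
Qed.

(** Each factor [z - a] of [q] is [(l - a)(1 - x)] with [x = (z - l) / (a - l)], so
    the square root of [1 - x] suffices.  The root obtained squares to [q]
    everywhere, not only near [l]. *)
Lemma has_power_series_sqrt_horner l (q : {poly C}) : q.[l] != 0 ->
  exists2 s : C -> C, (forall z, s z ^+ 2 = q.[z]) & has_power_series l s.
Proof.
move=> /horner_neq0_prod [c [rs [->]]].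
elim: rs => [_|a rs IH].
  exists (fun=> sqrtC c); last exact: has_power_series_cst.
  by move=> z; rewrite big_nil hornerZ hornerC mulr1 sqrtCK.
rewrite inE negb_or => /andP [la /IH [s s2 Hs]].
have [r r2 Hr] := exists_sqrt_power_series.
have al : a - l != 0 by rewrite subr_eq0 eq_sym.
have al' : (a - l)^-1 != 0 by rewrite invr_eq0.
exists (fun z => (sqrtC (l - a) * r ((a - l)^-1 * (z - l))) * s z); last first.
  apply: has_power_series_mul Hs; apply: has_power_series_mul.
    exact: has_power_series_cst.
  exact: has_power_series_scale.
move=> z; rewrite !exprMn s2 r2 sqrtCK big_cons !hornerZ hornerM hornerXsubC.
have -> : (l - a) * (1 - (a - l)^-1 * (z - l)) = z - a by field.
ring.
Qed.

Lemma has_power_series_cvg l f : has_power_series l f -> forall e, 0 < e ->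
  exists2 d, 0 < d & forall z, `|z - l| < d -> `|f z - f l| < e.
Proof.
move=> /has_power_series_lipschitz [K K0 HK] e e0.
have e1 : 0 < 1 + e by rewrite addr_gt0.
(* a radius where both K * d <= 1 and K * d <= e *)
exists (e / (1 + e) / K); first by rewrite !divr_gt0.
move=> z; rewrite ltr_pdivlMr // mulrC => Kz.
have Kz1 : K * `|z - l| <= 1.
  by apply: le_trans (ltW Kz) _; rewrite ler_pdivrMr // mul1r lerDr.
apply: le_lt_trans (HK z Kz1) (lt_le_trans Kz _).
by rewrite ler_pdivrMr // mulrDr mulr1 lerDl mulr_ge0 ?ltW.
Qed.

Lemma horner_neq0_near l q : q.[l] != 0 ->
  exists2 d, 0 < d & forall z, `|z - l| < d -> q.[z] != 0.
Proof.
move=> ql; have ql0 : 0 < `|q.[l]| by rewrite normr_gt0.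
have [d d0 Hd] := has_power_series_cvg (has_power_series_horner l q) ql0.
exists d => // z /Hd; apply: contraTneq => ->.
by rewrite sub0r normrN ltxx.
Qed.

End PowerSeries.

Lemma has_power_series_analytic_at (R : realType) (l : R[i]%C) (f : R[i]%C -> R[i]%C) :
  has_power_series l f -> analytic_at f l.
Proof.
move=> [a [M [rho [M0 rho0 H]]]]; exists a.
have r2 : 0 < (2 * rho)^-1 by rewrite invr_gt0 mulr_gt0.
apply/nbhs_ballP; exists ((2 * rho)^-1) => //= z; rewrite -ball_normE /= distrC => zl.
have zr2 : rho * `|z - l| <= 2^-1.
  rewrite -(ler_pM2l (_ : 0 < 2)) // mulrA divff ?pnatr_eq0 // mulrC.
  by rewrite -ler_pdivlMr ?mulr_gt0 // div1r ltW.
have zr : rho * `|z - l| <= 1 by rewrite (le_trans zr2) // invf_le1 // ler1n.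
apply/cvgrPdist_lt => e e0.
have eM : exists N0 : nat, M < e * N0%:R.
  have eR : e = (complex.Re e)%:C%C by rewrite RRe_real ?gtr0_real.
  have MR : M = (complex.Re M)%:C%C by rewrite RRe_real ?ger0_real.
  have e0' : 0 < complex.Re e by move: e0; rewrite eR ltcR.
  have M0' : 0 <= complex.Re M by move: M0; rewrite MR lecR.
  have := archi_boundP (divr_ge0 M0' (ltW e0')); set N0 := Num.bound _ => HN.
  exists N0; rewrite eR MR -(rmorph_nat (real_complex R)) -rmorphM ltcR.
  by rewrite mulrC -ltr_pdivrMr.
have [N0 HN0] := eM.
near=> N.
have NN0 : (N0 <= N)%N by near: N; exists N0.
rewrite /series /= big_mkord; apply: le_lt_trans (H z zr N) _.
apply: le_lt_trans (_ : M * 2^-1 ^+ N < e).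
  by rewrite ler_wpM2l // lerXn2r ?nnegrE ?mulr_ge0 ?invr_ge0 ?(ltW rho0).
rewrite exprVn ltr_pdivrMr ?exprn_gt0 //; apply: lt_le_trans HN0 _.
rewrite ler_pM2l // -natrX ler_nat; apply: leq_trans NN0 _.
exact: ltnW (ltn_expl _ _).
Unshelve. all: by end_near.
Qed.

(** * The unit circle *)

Section Circle.
Variable C : numClosedFieldType.
Implicit Types (a b d l s t v w x y z : C).

Lemma unit_conj z : `|z| = 1 -> z * z^* = 1.
Proof. by move=> z1; rewrite -normCK z1 expr1n. Qed.

(** This is what turns an even power of [z - l] into a positive factor times a
    unimodular one. *)
Lemma sub_circle_sqr z l : `|z| = 1 -> `|l| = 1 -> (z - l) ^+ 2 = - (l * z) * `|z - l| ^+ 2.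
Proof.
move=> /unit_conj z1 /unit_conj l1; rewrite normCK rmorphB /=.
have -> : - (l * z) * ((z - l) * (z^* - l^*)) = (z - l) * ((l * l^*) * z - (z * z^*) * l) by ring.
by rewrite z1 l1 !mul1r expr2.
Qed.

Lemma blaschke_factor_le a w : 1 <= `|a| -> `|w| < 1 ->
  `|1 - a^* * w| <= `|w - a| ?= iff (`|a| == 1).
Proof.
move=> a1 w1.
have E : `|w - a| ^+ 2 - `|1 - a^* * w| ^+ 2 = (`|a| ^+ 2 - 1) * (1 - `|w| ^+ 2).
  by rewrite !normCK !rmorphB !rmorphM /= !conjCK rmorph1; ring.
have w2 : 0 < 1 - `|w| ^+ 2 by rewrite subr_gt0 exprn_ilt1.
split; first by rewrite -(@ler_pXn2r _ 2) ?nnegrE // -subr_ge0 E mulr_ge0 ?(ltW w2) // subr_ge0 exprn_ege1.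
rewrite -(@eqrXn2 _ 2) // eq_sym -subr_eq0 E mulf_eq0 (gt_eqF w2) orbF subr_eq0.
by rewrite -[1 in LHS](expr1n _ 2) eqrXn2.
Qed.

(** The Cayley transform of [x], for real [x], rotated so that [x = 0] gives [t]. *)
Definition unit_shift t x : C := t * ((1 + 'i * x) / (1 - 'i * x)).

Lemma unit_shiftP t x : `|t| = 1 -> 0 < x ->
  [/\ `|unit_shift t x| = 1, unit_shift t x != t & `|unit_shift t x - t| <= 2 * x].
Proof.
move=> t1 x0; have xr : x^* = x by apply/CrealP; rewrite gtr0_real.
have t0 : t != 0 by rewrite -normr_eq0 t1 oner_eq0.
have En : (1 - 'i * x) * (1 + 'i * x) = 1 + x ^+ 2.
  have -> : (1 - 'i * x) * (1 + 'i * x) = 1 - 'i ^+ 2 * x ^+ 2 by ring.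
  by rewrite sqrCi; ring.
have sq : 1 <= 1 + x ^+ 2 by rewrite lerDl exprn_ge0 // ltW.
have conjn : (1 - 'i * x)^* = 1 + 'i * x by rewrite rmorphB rmorph1 rmorphM /= conjCi xr; ring.
have nn : `|1 - 'i * x| = `|1 + 'i * x| by rewrite -conjn norm_conjC.
have n1 : 1 <= `|1 - 'i * x|.
  by rewrite -(@ler_pXn2r _ 2) ?nnegrE // expr1n normCK conjn En.
have n0 : 1 - 'i * x != 0 by rewrite -normr_gt0 (lt_le_trans ltr01).
have Ed : unit_shift t x - t = t * (2 * 'i * x / (1 - 'i * x)).
  by rewrite /unit_shift; field.
split.
- by rewrite /unit_shift normrM t1 mul1r normrM normfV -nn divff // normr_eq0.
- rewrite -subr_eq0 Ed !mulf_neq0 ?invr_eq0 ?pnatr_eq0 ?(gt_eqF x0) //.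
  exact: neq0Ci.
rewrite Ed normrM t1 mul1r normrM !normrM normCi mulr1 normr_nat (gtr0_norm x0) normfV.
by rewrite ler_pdivrMr ?normr_gt0 // -[leLHS]mulr1 ler_pM2l // mulr_gt0.
Qed.

Lemma exists_unit_near t d : `|t| = 1 -> 0 < d ->
  exists2 z, `|z| = 1 & z != t /\ `|z - t| < d.
Proof.
move=> t1 d0; have x0 : 0 < d / 4 by rewrite divr_gt0.
have [h1 h2 h3] := unit_shiftP t1 x0; exists (unit_shift t (d / 4)) => //; split=> //.
apply: le_lt_trans h3 _; rewrite mulrCA -{2}[d]mulr1 ltr_pM2l //.
by rewrite ltr_pdivrMr // mul1r ltr_nat.
Qed.

Lemma exists_common_radius a b : 0 < a -> 0 < b -> exists c, [/\ 0 < c, c <= a & c <= b].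
Proof.
move=> a0 b0; case: (real_leP (gtr0_real a0) (gtr0_real b0)) => ab; [exists a|exists b] => //.
by rewrite ltW.
Qed.

Lemma sign_stable x y a : x \is Num.real -> y \is Num.real ->
  `|x - a| < `|a| / 2 -> `|y - a| < `|a| / 2 -> 0 < x -> 0 < y.
Proof.
move=> xr yr xa ya x0.
have lo u : `|u - a| < `|a| / 2 -> `|a| / 2 < `|u|.
  rewrite distrC => ua; have := ler_normD u (a - u).
  rewrite [u + _]addrC subrK => H.
  have : `|a| < `|u| + `|a| / 2 by rewrite (le_lt_trans H) // ltrD2l.
  by rewrite -ltrBlDr; have -> : `|a| - `|a| / 2 = `|a| / 2 by field.
case: (real_ltgtP (real0 _) yr) => // [y0|y0]; last first.
  by have := lo y ya; rewrite -y0 normr0 le_gtF ?divr_ge0.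
have := ltrD (lo x xa) (lo y ya); rewrite (gtr0_norm x0) (ltr0_norm y0).
have := ltrD xa ya; rewrite -[`|y - a|]normrN opprB => H H2.
have := le_lt_trans (ler_normD (x - a) (a - y)) H.
rewrite addrA subrK => H3; have := lt_trans H3 H2.
rewrite gtr0_norm ?ltxx // subr_gt0 (lt_trans y0) //.
Qed.

(** Dividing the equation by [z] expresses [b] as [v conj(a) conj(z) - a z]. *)
Lemma circle_root_le a b v z : `|v| = 1 -> `|z| = 1 ->
  a * z ^+ 2 + b * z - v * a^* = 0 -> `|b| <= 2 * `|a|.
Proof.
move=> v1 z1 E; have zz := unit_conj z1.
have Ebz : b * z = v * a^* - a * z ^+ 2.
  by apply/eqP; rewrite -subr_eq0 -E; apply/eqP; ring.
have -> : b = v * a^* * z^* - a * z.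
  rewrite -[LHS]mulr1 -zz mulrA Ebz mulrBl expr2; congr (_ - _).
  by rewrite -!mulrA zz mulr1.
apply: le_trans (ler_normB _ _) _.
by rewrite !normrM !norm_conjC v1 z1 !mulr1 mul1r mulr_natl mulr2n.
Qed.

(** The square of [s conj b] is a nonpositive real number, so [s conj b] is purely
    imaginary and [|s - b|^2 = |s|^2 + |b|^2 = 4 |a|^2]. *)
Lemma norm_circle_root a b s v : a != 0 -> `|v| = 1 -> b = - v * b^* ->
  s ^+ 2 = v * (4 * `|a| ^+ 2 - `|b| ^+ 2) -> `|b| <= 2 * `|a| ->
  `|(2 * a)^-1 * (- b + s)| = 1.
Proof.
move=> a0 v1 Eb Es le_ba.
set K := 4 * `|a| ^+ 2 - `|b| ^+ 2 in Es *.
have K0 : 0 <= K.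
  have -> : K = (2 * `|a|) ^+ 2 - `|b| ^+ 2 by rewrite /K; ring.
  by rewrite subr_ge0 lerXn2r // nnegrE mulr_ge0.
have ns : `|s| ^+ 2 = K by rewrite -normrX Es normrM v1 mul1r ger0_norm.
have bb : b * b^* = `|b| ^+ 2 by rewrite normCK.
have X2 : (s * b^*) ^+ 2 = - (K * `|b| ^+ 2).
  rewrite exprMn Es -bb {2}Eb; ring.
have X2' : (s^* * b) ^+ 2 = - (K * `|b| ^+ 2).
  have -> : s^* * b = (s * b^*)^* by rewrite rmorphM /= conjCK.
  rewrite -rmorphXn X2 rmorphN rmorphM /= rmorphXn /=.
  by rewrite (CrealP (ger0_real K0)) (CrealP (normr_real b)).
have cross : s * b^* + s^* * b = 0.
  suff : (s * b^* + s^* * b) ^+ 2 == 0 by rewrite expf_eq0 => /eqP.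
  have -> : (s * b^* + s^* * b) ^+ 2
    = (s * b^*) ^+ 2 + (s^* * b) ^+ 2 + 2 * ((s * s^*) * (b * b^*)) by ring.
  rewrite X2 X2' -!normCK ns; apply/eqP; ring.
have num : `|- b + s| ^+ 2 = (2 * `|a|) ^+ 2.
  rewrite normCK rmorphD rmorphN /=.
  have -> : (- b + s) * (- b^* + s^*) = b * b^* + s * s^* - (s * b^* + s^* * b) by ring.
  by rewrite cross -!normCK ns /K; ring.
have num1 : `|- b + s| = 2 * `|a|.
  by apply/eqP; rewrite -(@eqrXn2 _ 2) ?mulr_ge0 // num.
by rewrite normrM normfV normrM num1 normr_nat mulVf // mulf_neq0 ?normr_eq0 ?pnatr_eq0.
Qed.

End Circle.

(** * Reflection of polynomials in the circle *)

Section Reflection.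
Variable R : realType.
Local Notation C := (R[i]%C).
Implicit Types (q h : {poly C}) (a c w : C).

Lemma coef_reflect1 n q k :
  (reflect1 n q)`_k = if (k <= n)%N then (q`_(n - k))^* else 0.
Proof. by rewrite coef_poly ltnS. Qed.

Lemma size_reflect1 n q : (size (reflect1 n q) <= n.+1)%N.
Proof. exact: size_poly. Qed.

Lemma reflect1_circle n q w : (size q <= n.+1)%N -> `|w| = 1 ->
  (reflect1 n q).[w] = w ^+ n * (q.[w])^*.
Proof.
move=> sq w1; have w0 : w != 0 by rewrite -normr_eq0 w1 oner_eq0.
rewrite reflect1E //; suff -> : (w^*)^-1 = w by [].
by apply: (mulIf (_ : w^* != 0)); rewrite ?conjC_eq0 // mulVf ?conjC_eq0 // unit_conj.
Qed.

Lemma reflect1D n q h : reflect1 n (q + h) = reflect1 n q + reflect1 n h.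
Proof.
apply/polyP => k; rewrite coefD !coef_reflect1; case: ifP => _; last by rewrite addr0.
by rewrite coefD rmorphD.
Qed.

Lemma reflect1Z n c q : reflect1 n (c *: q) = c^* *: reflect1 n q.
Proof.
apply/polyP => k; rewrite coefZ !coef_reflect1; case: ifP => _; last by rewrite mulr0.
by rewrite coefZ rmorphM.
Qed.

Lemma reflect1K n q : (size q <= n.+1)%N -> reflect1 n (reflect1 n q) = q.
Proof.
move=> sq; apply/polyP => k; rewrite !coef_reflect1; case: leqP => kn.
  by rewrite leq_subr subKn // conjCK.
by rewrite nth_default // (leq_trans sq).
Qed.

Lemma reflect1_XsubC n a q : (size q <= n.+1)%N ->
  reflect1 n.+1 (('X - a%:P) * q) = (1 - a^* *: 'X) * reflect1 n q.
Proof.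
move=> sq; apply/polyP => k.
rewrite !mulrBl mul1r -scalerAl coef_reflect1 !coefB coefZ !coefXM !coef_reflect1 coefCM.
case: k => [|k] /=.
  by rewrite !subn0 [q`_n.+1]nth_default // !mulr0 !subr0.
rewrite ltnS subSS; case: (ltnP k n) => kn.
  by rewrite (ltnW kn) subn_eq0 leqNgt kn /= -subnS rmorphB rmorphM.
case: (leqP k n) => kn'.
  have /eqP -> : (n - k)%N == 0%N by rewrite subn_eq0.
  by rewrite /= !sub0r rmorphN rmorphM.
by rewrite mulr0 subr0.
Qed.

(** The reflection [h#] satisfies [|h#| <= |h|] on the open disk, where [h] has no
    zero, and the equality cases of the maximum principle hold: [h# / h] is either
    constant or of modulus less than [1] throughout. *)
Definition disk_dominates_reflection n h : Prop :=
  (forall w, `|w| < 1 -> h.[w] != 0 /\ `|(reflect1 n h).[w]| <= `|h.[w]|) /\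
  ((exists k, reflect1 n h = k *: h) \/
   (forall w, `|w| < 1 -> `|(reflect1 n h).[w]| < `|h.[w]|)).

(** [h# / h] is the finite product of the factors [(1 - conj(a) w) / (w - a)], each of
    modulus at most [1] in the disk and constant when [|a| = 1], times [w ^ (n - size rs)]. *)
Lemma disk_dominates_reflection_prod n rs : (size rs <= n)%N -> (forall a, a \in rs -> 1 <= `|a|) ->
  disk_dominates_reflection n (\prod_(a <- rs) ('X - a%:P)).
Proof.
elim: rs n => [|a rs IH] n srs Hrs.
  have E w : (reflect1 n (\prod_(a <- [::]) ('X - a%:P))).[w] = w ^+ n.
    have -> : reflect1 n (\prod_(a <- [::]) ('X - a%:P)) = 'X^n :> {poly C}.
      apply/polyP => k; rewrite big_nil coef_reflect1 coefXn coef1 -leqn0 leq_subLR addn0.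
      by rewrite eqn_leq; case: leqP => //= _; case: leqP => _; rewrite ?rmorph1 ?rmorph0.
    by rewrite hornerXn.
  split=> [w w1|].
    by rewrite E big_nil hornerC oner_neq0 normr1 normrX exprn_ile1 // ltW.
  case: n srs E => [|n] _ E; [left; exists 1 | right=> w w1].
    apply/polyP => k; rewrite scale1r big_nil coef_reflect1 coef1 leqn0.
    by case: k => [|k] /=; rewrite ?coef1 ?rmorph1.
  by rewrite E big_nil hornerC normr1 normrX exprn_ilt1.
case: n srs => // n srs.
have a1 : 1 <= `|a| by apply: Hrs; exact: mem_head.
have /= [IH1 IH2] := IH n srs (fun b brs => Hrs b (mem_behead (s := a :: rs) brs)).
rewrite /disk_dominates_reflection big_cons reflect1_XsubC; last by rewrite size_prod_XsubC.
set h := \prod_(_ <- _) _ in IH1 IH2 *.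
have E w : ((1 - a^* *: 'X) * reflect1 n h).[w] = (1 - a^* * w) * (reflect1 n h).[w].
  by rewrite hornerM hornerD hornerN hornerZ hornerX hornerC.
have wa w : `|w| < 1 -> w - a != 0.
  by move=> w1; rewrite subr_eq0; apply: contraTneq w1 => ->; rewrite le_gtF.
split=> [w w1|].
  have [h0 le_h] := IH1 w w1.
  rewrite E hornerM hornerXsubC mulf_neq0 ?wa // !normrM; split=> //.
  by apply: ler_pM => //; case: (blaschke_factor_le a1 w1).
have [/eqP aE|aN] := eqVneq `|a| 1; last first.
  right=> w w1; rewrite E hornerM hornerXsubC !normrM.
  have [h0 le_h] := IH1 w w1; apply: le_lt_trans (_ : `|1 - a^* * w| * `|h.[w]| < _).
    by rewrite ler_wpM2l.
  rewrite ltr_pM2r ?normr_gt0 // lt_neqAle.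
  by have [-> ->] := blaschke_factor_le a1 w1; rewrite andbT.
case: IH2 => [[k Ek]|lt_h].
  left; exists (- a^* * k); rewrite Ek.
  have aa : a^* * a = 1 by rewrite mulrC -normCK (eqP aE) expr1n.
  have -> : (1 : {poly C}) = (a^* * a)%:P by rewrite aa.
  rewrite polyCM -!mul_polyC polyCM polyCN; ring.
right=> w w1; rewrite E hornerM hornerXsubC !normrM.
have [le1 _] := blaschke_factor_le a1 w1.
apply: le_lt_trans (_ : `|w - a| * `|(reflect1 n h).[w]| < _).
  by rewrite ler_wpM2r.
by rewrite ltr_pM2l ?normr_gt0 ?wa // lt_h.
Qed.

(** A root in the disk is an equality case of [|h#| <= |h|], so [h#] is a multiple
    of [h] and the combination vanishes identically.  A root outside is reflected
    into the disk, as [f# = - conj(omega) f] for [f = omega h# - h]. *)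
Lemma self_inversive_root_circle n h omega w : `|omega| = 1 -> (size h <= n.+1)%N ->
  (forall z, `|z| < 1 -> h.[z] != 0) ->
  root (omega *: reflect1 n h - h) w -> omega *: reflect1 n h - h != 0 -> `|w| = 1.
Proof.
move=> o1 sh hN0 fw fN0.
set f := _ - _ in fw fN0.
have h0 : h != 0.
  have : h.[0] != 0 by apply: hN0; rewrite normr0.
  by apply: contraNneq => ->; rewrite horner0.
have oo : omega^* * omega = 1 by rewrite mulrC -normCK o1 expr1n.
have inside z : `|z| < 1 -> root f z -> False.
  move=> z1 /rootP fz.
  have [rs Eh srs] := poly_prod_roots h0 sh.
  set c := lead_coef h in Eh; set g := \prod_(_ <- _) _ in Eh.
  have c0 : c != 0 by rewrite lead_coef_eq0.
  have Hrs a : a \in rs -> 1 <= `|a|.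
    move=> ars; case: (real_leP (real1 _) (normr_real a)) => // a1.
    have := hN0 a a1; rewrite Eh hornerZ.
    have : root g a by rewrite root_prod_XsubC.
    by move/rootP => ->; rewrite mulr0 eqxx.
  have [d1 d2] := disk_dominates_reflection_prod srs Hrs.
  have [gz0 _] := d1 z z1.
  have Eg : omega * (c^* * (reflect1 n g).[z]) = c * g.[z].
    apply/eqP; rewrite -subr_eq0 -{}fz /f Eh reflect1Z; apply/eqP.
    by rewrite hornerD hornerN !hornerZ.
  case: d2 => [[k Ek]|/(_ z z1)]; last first.
    suff -> : `|(reflect1 n g).[z]| = `|g.[z]| by rewrite ltxx.
    apply: (mulfI (_ : `|c| != 0)); first by rewrite normr_eq0.
    by rewrite -[in RHS]normrM -Eg !normrM norm_conjC o1 mul1r.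
  move/eqP: fN0; apply; rewrite /f Eh reflect1Z -/g Ek.
  move: Eg; rewrite Ek hornerZ => Eg.
  have {}Eg : omega * (c^* * k) = c by apply: (mulIf gz0); rewrite -Eg; ring.
  by rewrite !scalerA -mulrA Eg subrr.
have nw : `|w| \is Num.real by exact: normr_real.
case: (real_ltgtP nw (real1 _)) => // w1; first by case: (inside w w1 fw).
have w0 : w != 0 by rewrite -normr_gt0 (lt_trans ltr01).
case: (inside (w^*)^-1); first by rewrite normfV norm_conjC invf_lt1 // normr_gt0.
have Ef : reflect1 n f = - omega^* *: f.
  rewrite /f reflect1D -scaleN1r !reflect1Z reflect1K // rmorphN1 !scaleN1r.
  by rewrite scaleNr scalerBr scalerA oo scale1r opprB.
have sf : (size f <= n.+1)%N.
  rewrite (leq_trans (size_polyD _ _)) // geq_max size_polyN sh andbT.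
  by rewrite (leq_trans (size_scale_leq _ _)) ?size_reflect1.
have := reflect1E sf w0; rewrite Ef hornerZ (rootP fw) mulr0 => /esym/eqP.
rewrite mulf_eq0 expf_eq0 (negPf w0) andbF /= conjC_eq0 => /eqP E.
exact/rootP.
Qed.

End Reflection.

(** * Slices of the denominator and of the fixed point polynomial *)

Section Bidegree.
Variables (R : realType) (n : nat) (alpha : R) (p : {poly {poly R[i]%C}}).
Hypothesis hp : normalized_denominator n p.
Local Notation C := (R[i]%C).
Local Notation omega := (expi alpha : C).
Local Notation p1 := (p`_0).
Local Notation p2 := (p`_1).
Local Notation Q := (Qalpha n alpha p).
Local Notation P := (Palpha n alpha p).
Implicit Types (z w t l : C) (s : C -> C).

Lemma norm_expi : `|omega| = 1.
Proof. by rewrite normc_def /= cos2Dsin2 sqrtr1. Qed.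

Lemma size_p1 : (size p1 <= n.+1)%N.
Proof. by rewrite -(deg_z2 hp) max_size_coefXY. Qed.

Lemma size_p2 : (size p2 <= n.+1)%N.
Proof. by rewrite -(deg_z2 hp) max_size_coefXY. Qed.

Lemma size_slice c : (size (p1 + c *: p2)%R <= n.+1)%N.
Proof.
rewrite (leq_trans (size_polyD _ _)) // geq_max size_p1.
by rewrite (leq_trans (size_scale_leq _ _)) ?size_p2.
Qed.

Lemma denominatorE : p = p1%:P + p2%:P * 'X.
Proof.
apply/polyP => k; rewrite coefD coefC coefCM coefX.
case: k => [|[|k]] /=; rewrite ?mulr0 ?mulr1 ?addr0 ?add0r //.
by rewrite nth_default // (deg_z1 hp).
Qed.

Lemma reflectE2 : Defs.reflect n p = (reflect1 n p2)%:P + (reflect1 n p1)%:P * 'X.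
Proof.
apply/polyP => k; rewrite coefD coefC coefCM coefX coef_poly.
by case: k => [|[|k]] /=; rewrite ?mulr0 ?mulr1 ?addr0 ?add0r.
Qed.

Lemma denominator_horner z1 z2 : p.[z1, z2] = p1.[z2] + z1 * p2.[z2].
Proof. by rewrite {1}denominatorE !hornerE mulrC. Qed.

Lemma reflect_horner z1 z2 :
  (Defs.reflect n p).[z1, z2] = (reflect1 n p2).[z2] + z1 * (reflect1 n p1).[z2].
Proof. by rewrite reflectE2 !hornerE mulrC. Qed.

Lemma Palpha_horner z1 z2 : P.[z1, z2] =
  omega * ((reflect1 n p2).[z2] + z1 * (reflect1 n p1).[z2])
  - z1 * (p1.[z2] + z1 * p2.[z2]).
Proof.
by rewrite /Palpha hornerD hornerN !hornerM hornerX hornerC hornerD hornerN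
  !hornerM !hornerC reflect_horner denominator_horner.
Qed.

Lemma Palpha_slice t : `|t| = 1 -> P.[t%:P] =
  t *: (omega *: reflect1 n (p1 + t *: p2) - (p1 + t *: p2)).
Proof.
move=> t1; have tt := unit_conj t1.
rewrite reflect1D reflect1Z /Palpha reflectE2 {3}denominatorE !hornerE.
rewrite scalerBr !scalerDr !scalerA.
have -> : t * omega * t^* = omega by rewrite mulrAC tt mul1r.
rewrite -!mul_polyC !polyCM.
ring.
Qed.

Lemma common_factor_unit (d a b : {poly {poly C}}) :
  p = a * d -> Defs.reflect n p = b * d -> d \is a GRing.unit.
Proof. by have := coprime_reflect hp; apply. Qed.

(** Otherwise [p1] and [p2], and with them their reflections, vanish at [z2], so that
    [X - z2] divides both [p] and its reflection. *)
Lemma p2_neq0_singular z1 z2 : `|z2| = 1 -> p.[z1, z2] = 0 -> p2.[z2] != 0.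
Proof.
move=> z21; rewrite denominator_horner => E; apply/eqP => E2.
have E1 : p1.[z2] = 0 by rewrite -E E2 mulr0 addr0.
have E1' : (reflect1 n p1).[z2] = 0 by rewrite reflect1_circle ?size_p1 // E1 rmorph0 mulr0.
have E2' : (reflect1 n p2).[z2] = 0 by rewrite reflect1_circle ?size_p2 // E2 rmorph0 mulr0.
move: E1 E2 E1' E2' => /rootP/factor_theorem[c1 e1] /rootP/factor_theorem[c2 e2].
move=> /rootP/factor_theorem[c1' e1'] /rootP/factor_theorem[c2' e2'].
have : ('X - z2%:P)%:P \is a @GRing.unit {poly {poly C}}.
  apply: common_factor_unit; first by rewrite denominatorE e1 e2 !polyCM mulrAC -mulrDl.
  by rewrite reflectE2 e1' e2' !polyCM mulrAC -mulrDl.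
by rewrite poly_unitE size_polyC coefC /= poly_unitE size_XsubC andbF.
Qed.

(** If [p1 = - t p2], then [z1 - t] divides both [p] and its reflection. *)
Lemma slice_neq0 t : `|t| = 1 -> p1 + t *: p2 != 0.
Proof.
move=> t1; apply/eqP => E; have tt := unit_conj t1.
have E1 : p1 = - t *: p2 by rewrite scaleNr; apply/eqP; rewrite -addr_eq0 E.
have : ('X - t%:P%:P) \is a @GRing.unit {poly {poly C}}.
  apply: (@common_factor_unit _ p2%:P (- t^* *: reflect1 n p2)%:P).
    rewrite {1}denominatorE E1 -!mul_polyC !polyCM !polyCN; ring.
  rewrite reflectE2 E1 reflect1Z rmorphN /=.
  have {1}-> : reflect1 n p2 = (t * t^*)%:P * reflect1 n p2 by rewrite tt mul1r.
  rewrite -!mul_polyC !polyCM !polyCN; ring.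
by rewrite poly_unitE size_XsubC.
Qed.

(** For [r < 1] the slice of [p] at [r t] has no zero in the disk, and
    these slices tend to the one at [t]. *)
Lemma slice_rootfree t w : `|t| = 1 -> `|w| < 1 -> (p1 + t *: p2).[w] != 0.
Proof.
move=> t1 w1; apply/eqP => E; have /eqP := slice_neq0 t1; apply.
have tx0 x : 0 < x -> x < 1 -> `|(1 - x) * t| < 1.
  move=> x0 x1; rewrite normrM t1 mulr1 ger0_norm ?subr_ge0 ?(ltW x1) //.
  by rewrite gtrBl.
apply: (@rootfree_limit _ n _ (fun x => p1 + ((1 - x) * t) *: p2) w (1 - `|w|)) => //.
- by rewrite subr_gt0.
- by move=> x _ _; exact: size_slice.
- move=> x x0 x1 a /rootP Ea.
  have a1 : 1 <= `|a|.
    case: (real_leP (real1 _) (normr_real a)) => // a1.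
    have := no_zero_bidisk hp (tx0 x x0 x1) a1.
    by rewrite denominator_horner -hornerZ -hornerD Ea eqxx.
  rewrite distrC; apply: le_trans (lerB_dist _ _); by rewrite lerD2r.
- move=> z; exists `|p2.[z]| => // x x0 x1.
  rewrite !hornerD !hornerZ.
  have -> : p1.[z] + t * p2.[z] - (p1.[z] + (1 - x) * t * p2.[z]) = x * t * p2.[z] by ring.
  by rewrite !normrM t1 mulr1 (gtr0_norm x0) mulrC.
Qed.

Lemma Palpha_root_circle t w : `|t| = 1 -> P.[t, w] = 0 ->
  P.[t%:P] != 0 -> `|w| = 1.
Proof.
move=> t1; have t0 : t != 0 by rewrite -normr_eq0 t1 oner_eq0.
rewrite Palpha_slice // hornerZ => /eqP; rewrite mulf_eq0 (negPf t0) /= => rt.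
rewrite scale_poly_eq0 (negPf t0) /= => nz.
apply: self_inversive_root_circle norm_expi _ _ rt nz.
  exact: size_slice.
by move=> z z1; exact: slice_rootfree.
Qed.

(** * Fixed points over a point of the circle *)

(** The opposite of the coefficient of [z1] in [P]. *)
Definition bcoef : {poly C} := p1 - omega *: reflect1 n p1.

Lemma bcoef_horner z : bcoef.[z] = p1.[z] - omega * (reflect1 n p1).[z].
Proof. by rewrite /bcoef hornerD hornerN hornerZ. Qed.

Lemma Qalpha_horner z :
  Q.[z] = bcoef.[z] ^+ 2 + 4 * (omega * (p2.[z] * (reflect1 n p2).[z])).
Proof. by rewrite /Qalpha hornerD horner_exp !hornerZ hornerM. Qed.

Lemma norm_twist z : `|z| = 1 -> `|omega * z ^+ n| = 1.
Proof. by move=> z1; rewrite normrM norm_expi normrX z1 expr1n mulr1. Qed.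

Lemma bcoef_circle z : `|z| = 1 -> bcoef.[z] = - (omega * z ^+ n) * (bcoef.[z])^*.
Proof.
move=> z1; rewrite bcoef_horner (reflect1_circle size_p1) //.
have vv := unit_conj (norm_twist z1); rewrite mulrA; set v := omega * z ^+ n in vv *.
rewrite rmorphB rmorphM /= conjCK.
have -> : - v * (p1.[z]^* - v^* * p1.[z]) = v * v^* * p1.[z] - v * p1.[z]^* by ring.
by rewrite vv mul1r.
Qed.

Lemma Qalpha_circle z : `|z| = 1 -> Q.[z] =
  (omega * z ^+ n) * (4 * `|p2.[z]| ^+ 2 - `|bcoef.[z]| ^+ 2).
Proof.
move=> z1; rewrite Qalpha_horner (reflect1_circle size_p2) //.
rewrite !normCK mulrBr.
have -> : omega * z ^+ n * (bcoef.[z] * (bcoef.[z])^*) = - bcoef.[z] ^+ 2.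
  by rewrite [in RHS]expr2 {3}bcoef_circle //; ring.
ring.
Qed.

Lemma Palpha_complete_square z1 z2 :
  - 4 * p2.[z2] * P.[z1, z2] = (2 * p2.[z2] * z1 + bcoef.[z2]) ^+ 2 - Q.[z2].
Proof.
by rewrite Palpha_horner // Qalpha_horner bcoef_horner; ring.
Qed.

Lemma Palpha_quadratic z1 z2 : `|z2| = 1 ->
  - P.[z1, z2] = p2.[z2] * z1 ^+ 2 + bcoef.[z2] * z1 - (omega * z2 ^+ n) * p2.[z2]^*.
Proof.
move=> z21; rewrite Palpha_horner (reflect1_circle size_p2) // bcoef_horner; ring.
Qed.

Lemma Palpha_singular z1 z2 : `|z1| = 1 -> `|z2| = 1 -> p.[z1, z2] = 0 -> P.[z1, z2] = 0.
Proof.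
move=> z11 z21 E; rewrite Palpha_horner -denominator_horner E mulr0 subr0.
rewrite !reflect1_circle ?size_p1 ?size_p2 //.
have -> : z2 ^+ n * p2.[z2]^* + z1 * (z2 ^+ n * p1.[z2]^*)
  = z1 * z2 ^+ n * (p.[z1, z2])^*.
  rewrite denominator_horner rmorphD rmorphM /=.
  have -> : z1 * z2 ^+ n * (p1.[z2]^* + z1^* * p2.[z2]^*) =
     (z1 * z1^*) * (z2 ^+ n * p2.[z2]^*) + z1 * (z2 ^+ n * p1.[z2]^*) by ring.
  by rewrite unit_conj // mul1r.
by rewrite E rmorph0 !mulr0.
Qed.

Lemma psi_cancel s j z : p2.[z] != 0 ->
  2 * p2.[z] * psi n alpha p s j z + bcoef.[z] = (-1) ^+ j * s z.
Proof.
move=> pz; have h : 2 * p2.[z] != 0 by rewrite mulf_neq0 ?pnatr_eq0.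
by rewrite /psi mulrA divff // mul1r bcoef_horner; ring.
Qed.

Lemma Palpha_psi s j z : is_sqrtQ n alpha p s -> p2.[z] != 0 ->
  P.[psi n alpha p s j z, z] = 0.
Proof.
move=> s2 pz; have := Palpha_complete_square (psi n alpha p s j z) z.
rewrite psi_cancel // exprMn s2 -exprM mulnC exprM sqrrN !expr1n mul1r subrr.
by move/eqP; rewrite !mulf_eq0 (negPf pz) oppr_eq0 pnatr_eq0 /= => /eqP.
Qed.

Lemma Palpha_root_psi s z1 z2 : is_sqrtQ n alpha p s -> p2.[z2] != 0 ->
  P.[z1, z2] = 0 -> exists j, z1 = psi n alpha p s j z2.
Proof.
move=> s2 pz E; have := Palpha_complete_square z1 z2; rewrite E mulr0 => /esym/eqP.
have h : 2 * p2.[z2] != 0 by rewrite mulf_neq0 ?pnatr_eq0.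
rewrite -s2 subr_eq0 eqf_sqr => H.
suff [j Hj] : exists j : bool, 2 * p2.[z2] * z1 + bcoef.[z2] = (-1) ^+ j * s z2.
  exists j; apply: (mulfI h); apply: (addIr bcoef.[z2]).
  by rewrite Hj psi_cancel.
case/orP: H => /eqP ->; [exists false | exists true];
  by rewrite ?expr0 ?expr1 ?mul1r ?mulN1r.
Qed.

Lemma psi_eq s z : is_sqrtQ n alpha p s -> p2.[z] != 0 ->
  psi n alpha p s false z = psi n alpha p s true z -> Q.[z] = 0.
Proof.
move=> s2 pz E; have := psi_cancel s false pz; rewrite E psi_cancel // expr0 expr1 mul1r mulN1r.
move/eqP; rewrite eq_sym -addr_eq0 -mulr2n mulrn_eq0 /= => /eqP sz.
by rewrite -s2 sz expr0n.
Qed.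

Lemma componentE s j z1 z2 : is_sqrtQ n alpha p s ->
  component n alpha p s j (z1, z2) <->
  [/\ `|z1| = 1, `|z2| = 1, p2.[z2] != 0 & z1 = psi n alpha p s j z2].
Proof.
move=> s2; split; first by case=> [[_ [/= ? ?]] [/= ? ?]].
move=> [z11 z21 pz Ez]; do 2!split=> //=; split=> /=; rewrite ?z11 ?z21 //.
by rewrite Ez Palpha_psi.
Qed.

(** Nonnegativity of the discriminant up to the factor [omega z^n].  The name is that of
    a disk automorphism [phi(., z)] whose fixed points are on the circle; the parabolic
    case of a double fixed point is included. *)
Definition hyperbolic z : Prop := `|bcoef.[z]| <= 2 * `|p2.[z]|.

Lemma hyperbolic_root z1 z2 : `|z1| = 1 -> `|z2| = 1 -> P.[z1, z2] = 0 -> hyperbolic z2.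
Proof.
move=> z11 z21 E; apply: (circle_root_le (norm_twist z21) z11).
by rewrite -Palpha_quadratic // E oppr0.
Qed.

Lemma norm_psi s j z : is_sqrtQ n alpha p s -> `|z| = 1 -> p2.[z] != 0 ->
  hyperbolic z -> `|psi n alpha p s j z| = 1.
Proof.
move=> s2 z1 pz hz.
have := norm_circle_root (s := (-1) ^+ j * s z) pz (norm_twist z1) (bcoef_circle z1) _ hz.
rewrite exprMn s2 -exprM mulnC exprM sqrrN !expr1n mul1r Qalpha_circle // => /(_ erefl) <-.
by rewrite /psi bcoef_horner.
Qed.

Lemma hyperbolicE z : hyperbolic z <-> 0 <= 4 * `|p2.[z]| ^+ 2 - `|bcoef.[z]| ^+ 2.
Proof.
have -> : 4 * `|p2.[z]| ^+ 2 = (2 * `|p2.[z]|) ^+ 2 by ring.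
by rewrite subr_ge0 ler_pXn2r // nnegrE mulr_ge0.
Qed.

(** On the circle [(z - l)^2 = - l z |z - l|^2], so an even order zero of [Q]
    contributes a positive factor to the discriminant; the remaining factor [F] is
    continuous and nonzero at [l], hence of constant sign near [l]. *)
Lemma hyperbolic_near m (Q1 : {poly C}) l : `|l| = 1 ->
  Q = Q1 * ('X - l%:P) ^+ m.*2 -> Q1.[l] != 0 ->
  (forall d, 0 < d -> exists z, [/\ `|z| = 1, `|z - l| < d, Q.[z] != 0 & hyperbolic z]) ->
  exists2 d, 0 < d & forall z, `|z| = 1 -> `|z - l| < d -> hyperbolic z.
Proof.
move=> l1 EQ Q1l acc.
have unit0 z : `|z| = 1 -> z != 0 by move=> z1; rewrite -normr_eq0 z1 oner_eq0.
pose D z := 4 * `|p2.[z]| ^+ 2 - `|bcoef.[z]| ^+ 2.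
pose K : {poly C} := (- l *: 'X) ^+ m * Q1.
pose V : {poly C} := omega *: 'X^n.
pose F z := K.[z] * V.[z]^-1.
have Vz z : V.[z] = omega * z ^+ n by rewrite /V !hornerE.
have V0 z : `|z| = 1 -> V.[z] != 0 by move=> z1; rewrite -normr_eq0 Vz norm_twist ?oner_eq0.
(* D is the discriminant up to the unimodular factor V *)
have DF z : `|z| = 1 -> D z = `|z - l| ^+ m.*2 * F z.
  move=> z1; apply: (mulfI (V0 z z1)).
  rewrite {1}Vz -Qalpha_circle // EQ hornerM horner_exp hornerXsubC -mul2n !exprM.
  rewrite sub_circle_sqr // exprMn /F.
  have -> : V.[z] * ((`|z - l| ^+ 2) ^+ m * (K.[z] / V.[z])) = (`|z - l| ^+ 2) ^+ m * K.[z].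
    by rewrite mulrCA [V.[z] * _]mulrC mulfVK ?V0.
  rewrite /K hornerM horner_exp hornerZ hornerX mulNr; ring.
have Fl : 0 < `|F l| / 2.
  rewrite divr_gt0 // normr_gt0 mulf_neq0 ?invr_eq0 ?V0 //.
  by rewrite /K hornerM horner_exp hornerZ hornerX mulf_neq0 // expf_neq0 // mulf_neq0 ?oppr_eq0 ?unit0.
have Fps : has_power_series l F.
  apply: has_power_series_mul (has_power_series_horner l K) _.
  by apply: has_power_series_inv_horner; rewrite V0.
have [d d0 Hd] := has_power_series_cvg Fps Fl.
have Dreal z : D z \is Num.real.
  by rewrite realB // realX ?realM ?realn ?normr_real.
have Freal z : `|z| = 1 -> 0 < `|z - l| ^+ m.*2 -> F z \is Num.real.
  move=> z1 c0; have -> : F z = D z / `|z - l| ^+ m.*2.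
    by rewrite DF // mulrAC divff ?mul1r // gt_eqF.
  by rewrite realM // realV gtr0_real.
have [z0 [z01 z0l Qz0 hz0]] := acc d d0.
have D0 : 0 < D z0.
  rewrite lt0r; move/hyperbolicE: hz0 => ->; rewrite andbT.
  by apply: contraNneq Qz0 => Dz; rewrite Qalpha_circle // -/(D z0) Dz mulr0.
have c0 : 0 < `|z0 - l| ^+ m.*2.
  rewrite lt0r exprn_ge0 // andbT; apply: contraTneq D0 => E.
  by rewrite DF // E mul0r ltxx.
have F0 : 0 < F z0 by move: D0; rewrite DF // pmulr_rgt0.
exists d => // z z1 zl; apply/hyperbolicE; rewrite -/(D z) DF //.
have := exprn_ge0 m.*2 (normr_ge0 (z - l)); rewrite le_eqVlt => /orP [/eqP <-|c].
  by rewrite mul0r.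
rewrite mulr_ge0 ?(ltW c) // ltW //.
exact: (sign_stable (Freal _ z01 c0) (Freal _ z1 c) (Hd _ z0l) (Hd _ zl)).
Qed.

(** * The fixed point curves near a singular point *)

Lemma size_Palpha_slice t : `|t| = 1 -> (size (P.[t%:P]) <= n.+1)%N.
Proof.
move=> t1; rewrite Palpha_slice //.
rewrite (leq_trans (size_scale_leq _ _)) // (leq_trans (size_polyD _ _)) //.
by rewrite geq_max size_polyN size_slice (leq_trans (size_scale_leq _ _)) ?size_reflect1.
Qed.

(** The circle is swept in the variable [z1]: for unimodular [t] close to [tau], all
    roots of [P(t, .)] are unimodular and, by Hurwitz, one of them is close to [l].  It
    is not [l], since [P(., l)] has [tau] as its only root.  If [P(tau, .)] vanishes
    identically, any point of the circle will do. *)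
Lemma double_root_approached tau l : `|tau| = 1 -> `|l| = 1 ->
  p.[tau, l] = 0 -> Q.[l] = 0 -> forall d, 0 < d ->
  exists z1 z2, [/\ `|z1| = 1, `|z2| = 1, z2 != l, `|z2 - l| < d & P.[z1, z2] = 0].
Proof.
move=> tau1 l1 ptl Ql d d0.
have pl := p2_neq0_singular l1 ptl.
have Ptl := Palpha_singular tau1 l1 ptl.
have Pl0 t : t != tau -> P.[t, l] != 0.
  have := Palpha_complete_square tau l.
  rewrite Ptl Ql mulr0 subr0 => /esym/eqP; rewrite expf_eq0 /= => /eqP B.
  move=> tt; have := Palpha_complete_square t l; rewrite Ql subr0.
  have -> : 2 * p2.[l] * t + bcoef.[l] = 2 * p2.[l] * (t - tau).
    by rewrite mulrBr -[LHS]subr0 -B; ring.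
  by move=> E; apply: contraTneq tt => Z; move/esym/eqP: E;
    rewrite Z mulr0 expf_eq0 /= !mulf_eq0 pnatr_eq0 (negPf pl) subr_eq0 negbK.
(* Palpha may contain the horizontal line z1 = tau *)
have [P0|PN0] := eqVneq (P.[tau%:P]) 0.
  have [z z1 [zl zd]] := exists_unit_near l1 d0.
  by exists tau, z; split=> //; rewrite P0 horner0.
case: (pselect (exists z1 z2, [/\ `|z1| = 1, `|z2| = 1, z2 != l, `|z2 - l| < d & P.[z1, z2] = 0])) => // none.
case/eqP: PN0; pose g x := P.[(unit_shift tau x)%:P].
(* the roots of all slices g x stay away from l, so their limit cannot vanish there *)
apply: (@rootfree_limit _ n _ g l d) => //.
- by move=> x x0 _; have [u1 _ _] := unit_shiftP tau1 x0; exact: size_Palpha_slice.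
- move=> x x0 _ a /rootP ra; have [u1 ut _] := unit_shiftP tau1 x0.
  have gN0 : g x != 0.
    by apply: contraNneq (Pl0 _ ut) => g0; rewrite -/(g x) g0 horner0.
  have a1 := Palpha_root_circle u1 ra gN0.
  rewrite distrC; case: (real_leP (gtr0_real d0) (normr_real (a - l))) => // ad.
  case: none; exists (unit_shift tau x), a; split=> //.
  by apply: contraNneq (Pl0 _ ut) => <-; rewrite ra.
move=> z; set A := p2.[z]; set B := bcoef.[z].
exists (2 * (2 * `|A| + `|B|)) => [|x x0 _].
  by rewrite mulr_ge0 ?addr_ge0 ?mulr_ge0.
have [u1 _ ud] := unit_shiftP tau1 x0; set u := unit_shift tau x in u1 ud *.
have -> : P.[tau%:P].[z] - (g x).[z] = (u - tau) * (A * (u + tau) + B).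
  by rewrite /g -/u !Palpha_horner /A /B bcoef_horner; ring.
rewrite normrM mulrAC; apply: ler_pM => //.
apply: le_trans (ler_normD _ _) _; rewrite lerD2r normrM mulrC ler_wpM2r //.
by apply: le_trans (ler_normD _ _) _; rewrite u1 tau1.
Qed.

(** The zeros of [Q] and [p2] are isolated, so they can be avoided. *)
Lemma double_root_hyperbolic tau l : `|tau| = 1 -> `|l| = 1 ->
  p.[tau, l] = 0 -> Q.[l] = 0 -> Q != 0 -> forall d, 0 < d ->
  exists z1 z2, [/\ `|z1| = 1, `|z2| = 1 & [/\ `|z2 - l| < d, P.[z1, z2] = 0,
    p2.[z2] != 0 & Q.[z2] != 0]].
Proof.
move=> tau1 l1 ptl Ql Q0 d d0.
have [m [Q1 Q1l EQ]] := multiplicity_XsubC Q l; rewrite Q0 /= in Q1l.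
have [d1 d10 Hd1] := horner_neq0_near (p2_neq0_singular l1 ptl).
have [d2 d20 Hd2] := horner_neq0_near Q1l.
have [e [e0 ed ed1]] := exists_common_radius d0 d10.
have [e' [e'0 ee ed2]] := exists_common_radius e0 d20.
have [z1 [z2 [z11 z21 zl ze Pz]]] := double_root_approached tau1 l1 ptl Ql e'0.
exists z1, z2; split=> //; split=> //.
- by rewrite (lt_le_trans ze) // (le_trans ee).
- by rewrite Hd1 // (lt_le_trans ze) // (le_trans ee).
rewrite EQ hornerM horner_exp hornerXsubC mulf_neq0 ?expf_neq0 ?subr_eq0 //.
by rewrite Hd2 // (lt_le_trans ze).
Qed.

(** The square root of [Q] used for the labelling is [(z - l)^m] times an analytic
    root of [Q1]. *)
Lemma even_order_parametrized tau l m (Q1 : {poly C}) : `|tau| = 1 -> `|l| = 1 ->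
  p.[tau, l] = 0 -> Q = Q1 * ('X - l%:P) ^+ m.*2 -> Q1.[l] != 0 ->
  (forall d, 0 < d -> exists z, [/\ `|z| = 1, `|z - l| < d, Q.[z] != 0 &
     hyperbolic z]) ->
  exists2 s, is_sqrtQ n alpha p s & forall j,
    component n alpha p s j (tau, l) ->
    analytically_parametrized (component n alpha p s j) (tau, l).
Proof.
move=> tau1 l1 ptl EQ Q1l acc.
have pl := p2_neq0_singular l1 ptl.
have [d d0 Hd] := hyperbolic_near l1 EQ Q1l acc.
have [d1 d10 Hd1] := horner_neq0_near pl.
have [e [e0 ed ed1]] := exists_common_radius d0 d10.
have [r r2 Hr] := has_power_series_sqrt_horner Q1l.
pose s z := (('X - l%:P) ^+ m).[z] * r z.
have s2 : is_sqrtQ n alpha p s.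
  by move=> z; rewrite /s exprMn r2 EQ hornerM -muln2 exprM [in RHS]horner_exp mulrC.
exists s => // j Hj; exists (psi n alpha p s j); split.
- apply: has_power_series_analytic_at.
  have p0 : (2 *: p2).[l] != 0 by rewrite hornerZ mulf_neq0 ?pnatr_eq0.
  have H1 := has_power_series_inv_horner p0.
  have H2 := has_power_series_mul
    (has_power_series_horner l ((-1) ^+ j *: ('X - l%:P) ^+ m)) Hr.
  have H3 := has_power_series_add (has_power_series_horner l (- bcoef)) H2.
  apply: eq_has_power_series (has_power_series_mul H1 H3) => z.
  by rewrite /psi /s !hornerZ hornerN bcoef_horner mulrA.
- by case/(componentE _ _ _ s2): Hj.
apply/nbhs_ballP; exists e => //= -[z1 z2] [_ /=]; rewrite -ball_normE /= distrC => ze.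
rewrite (componentE _ _ _ s2); split; first by case.
move=> [z21 ->]; have pz : p2.[z2] != 0 by rewrite Hd1 // (lt_le_trans ze).
split=> //; apply: norm_psi => //; apply: Hd => //.
exact: lt_le_trans ed.
Qed.

End Bidegree.

Unset Implicit Arguments.

Theorem theorem4p14 (R : realType) (n : nat) (alpha : R)
    (p : {poly {poly R[i]%C}}) (tau lambda : R[i]%C)
    (hp : normalized_denominator n p)
    (hQ : Qalpha n alpha p != 0)
    (hsf : SF_point n alpha p (tau, lambda)) :
  ((Qalpha n alpha p).[lambda] != 0 ->
     (forall s, is_sqrtQ n alpha p s ->
        exists! j : bool, component n alpha p s j (tau, lambda)) /\
     (exists2 s, is_sqrtQ n alpha p s &
        forall j : bool, component n alpha p s j (tau, lambda) ->
          analytically_parametrized (component n alpha p s j) (tau, lambda))) /\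
  ((Qalpha n alpha p).[lambda] = 0 ->
     (forall s, is_sqrtQ n alpha p s ->
        component n alpha p s false <> component n alpha p s true /\
        forall j : bool, component n alpha p s j (tau, lambda)) /\
     (~~ odd (mup lambda (Qalpha n alpha p)) ->
        exists2 s, is_sqrtQ n alpha p s &
        forall j : bool,
          analytically_parametrized (component n alpha p s j) (tau, lambda))).
Proof.
have [[[tau1 l1] ptl] _] := hsf; rewrite /= in tau1 l1 ptl.
have pl := p2_neq0_singular hp l1 ptl.
have Ptl := Palpha_singular alpha hp tau1 l1 ptl.
split=> [Ql|Ql].
  split=> [s s2|].
    have [j Ej] := Palpha_root_psi hp s2 pl Ptl.
    exists j; split; first by apply/(componentE hp _ _ _ s2).
    move=> k /(componentE hp _ _ _ s2) [_ _ _ Ek].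
    case: j k Ej Ek => -[] //= E1 E2; move/eqP: Ql => [];
      apply: (psi_eq s2 pl); by rewrite -E1 -E2.
  apply: (@even_order_parametrized _ _ _ _ hp _ _ 0 (Qalpha n alpha p)) => //.
    by rewrite expr0 mulr1.
  move=> d d0; exists lambda; split=> //; first by rewrite subrr normr0.
  exact: (hyperbolic_root hp tau1 l1 Ptl).
have comp_all s : is_sqrtQ n alpha p s -> forall j, component n alpha p s j (tau, lambda).
  move=> s2 j; apply/(componentE hp _ _ _ s2); split=> //.
  have [k ->] := Palpha_root_psi hp s2 pl Ptl.
  (* both branches take at lambda the value of the double root *)
  have sl : s lambda = 0 by have /eqP := s2 lambda; rewrite Ql expf_eq0 => /eqP.
  by rewrite /psi sl !mulr0.
split=> [s s2|ev].
  split; last exact: comp_all.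
  have [z1 [z2 [z11 z21 [_ Pz pz Qz]]]] :=
    double_root_hyperbolic hp tau1 l1 ptl Ql hQ ltr01.
  move=> Ecomp; have [j Ej] := Palpha_root_psi hp s2 pz Pz.
  have Hj : component n alpha p s j (z1, z2) by apply/(componentE hp _ _ _ s2).
  have [Hf Ht] : component n alpha p s false (z1, z2) /\ component n alpha p s true (z1, z2).
    by case: j {Ej} Hj => H; split; rewrite ?Ecomp // -Ecomp.
  move/eqP: Qz; apply; apply: (psi_eq s2 pz).
  by case/(componentE hp _ _ _ s2): Hf => _ _ _ <-; case/(componentE hp _ _ _ s2): Ht.
have [m [Q1 Q1l EQ]] := multiplicity_XsubC (Qalpha n alpha p) lambda; rewrite hQ /= in Q1l.
have Em : mup lambda (Qalpha n alpha p) = m.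
  by rewrite EQ mupMr // mup_XsubCX eqxx.
have {}EQ : Qalpha n alpha p = Q1 * ('X - lambda%:P) ^+ (m./2).*2.
  by rewrite -[RHS]/(Q1 * _) even_halfK // -Em.
have [d d0|s s2 Hs] := even_order_parametrized hp tau1 l1 ptl EQ Q1l.
  have [z1 [z2 [z11 z21 [zd Pz pz Qz]]]] :=
    double_root_hyperbolic hp tau1 l1 ptl Ql hQ d0.
  by exists z2; split=> //; exact: (hyperbolic_root hp z11 z21 Pz).
by exists s => // j; apply: Hs; apply: comp_all.
Qed.
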